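(* Let $\mathfrak{g}$ be a locally reductive Lie algebra and $\mathfrak{h}$ a subalgebra of $\mathfrak{g}$. The following conditions on $\mathfrak{h}$ are equivalent: (1) $\mathfrak{h}$ is a Cartan subalgebra of $\mathfrak{g}$; (2) $\mathfrak{h} = \mathfrak{z}_{\mathfrak{g}}(\mathfrak{h}_{ss})$ and $\mathfrak{h}_{ss}$ is a subalgebra; (3) $\mathfrak{h} = \mathfrak{z}_{\mathfrak{g}}(\mathfrak{t})$ for some maximal toral subalgebra $\mathfrak{t} \subseteq \mathfrak{g}$; (4) $\mathfrak{h} = \overline{\mathfrak{g}^0(\mathfrak{h})}$. In addition, any Cartan subalgebra $\mathfrak{h}$ of $\mathfrak{g}$ is splittable and self-normalizing.
   Context: All Lie algebras are over $\mathbb{C}$. A Lie algebra $\mathfrak{g}$ is locally reductive if it is a union $\bigcup_{i\in\mathbb{Z}_{>0}}\mathfrak{g}_i$ of nested finite-dimensional reductive Lie subalgebras $\mathfrak{g}_i\subseteq\mathfrak{g}_{i+1}$ such that $\mathfrak{g}_i$ is reductive in $\mathfrak{g}_{i+1}$ (i.e. the adjoint action of $\mathfrak{g}_i$ on $\mathfrak{g}_{i+1}$ is semisimple). In a finite-dimensional reductive Lie algebra an element is semisimple if its adjoint endomorphism is semisimple, and nilpotent if it lies in the derived algebra and its adjoint endomorphism is nilpotent; these notions are preserved under the inclusions $\mathfrak{g}_i\subseteq\mathfrak{g}_{i+1}$, so semisimple and nilpotent elements of $\mathfrak{g}$ and the Jordan decomposition $x=x_{ss}+x_{nil}$ (commuting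 semisimple and nilpotent parts) of every $x\in\mathfrak{g}$ are well defined. For a subalgebra $\mathfrak{h}\subseteq\mathfrak{g}$, $\mathfrak{h}_{ss}:=\{h_{ss}: h\in\mathfrak{h}\}$ is the set of semisimple Jordan components of elements of $\mathfrak{h}$. $\mathfrak{h}$ is splittable if $h_{ss},h_{nil}\in\mathfrak{h}$ for every $h\in\mathfrak{h}$. A subalgebra is toral if all its elements are semisimple. $\mathfrak{z}_{\mathfrak{g}}(\mathfrak{a})$ is the centralizer in $\mathfrak{g}$ of the subset $\mathfrak{a}$. A Lie algebra is locally nilpotent if every finite subset is contained in a nilpotent subalgebra. A subalgebra $\mathfrak{h}\subseteq\mathfrak{g}$ is a Cartan subalgebra if $\mathfrak{h}$ is locally nilpotent and $\mathfrak{h}=\mathfrak{z}_{\mathfrak{g}}(\mathfrak{h}_{ss})$. For a subalgebra $\mathfrak{k}\subseteq\mathfrak{g}$, $\mathfrak{g}^0(\mathfrak{k}):=\{m\in\mathfrak{g}:\exists\, i\in\mathbb{Z}_{>0}\text{ such that }(\mathrm{ad}\,x)^i(m)=0\ \forall x\in\mathfrak{k}\}$. For a subalgebra $\mathfrak{h}$, $\overline{\mathfrak{g}^0(\mathfrak{h})}:=\bigcap_i\mathfrak{g}^0(\mathfrak{h}_i)$, where $\mathfrak{h}=\bigcup_i\mathfrak{h}_i$ is any exhaustion of $\mathfrak{h}$ by nested finite-dimensional subalgebras; equivalently, it is the intersection of $\mathfrak{g}^0(\mathfrak{h}_{fin})$ over all finite-dimensional subalgebras $\mathfrak{h}_{fin}$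 of $\mathfrak{h}$. *)

(* Defs.v *)
From HB Require Import structures.
From mathcomp Require Import all_boot all_order all_algebra.
From mathcomp Require Import boolp classical_sets functions cardinality.
From mathcomp Require Import reals complex.

Set Implicit Arguments.
Unset Strict Implicit.
Unset Printing Implicit Defensive.

Import GRing.Theory.
Local Open Scope classical_set_scope.
Local Open Scope ring_scope.

HB.mixin Record Lmodule_isLieAlgebra (K : fieldType) (L : Type)
    of GRing.Lmodule K L := {
  lie : L -> L -> L;
  lie_linearl : forall (a : K) (x y z : L),
    lie (a *: x + y) z = a *: lie x z + lie y z;
  lie_linearr : forall (a : K) (x y z : L),
    lie x (a *: y + z) = a *: lie x y + lie x z;
  lie_alternating : forall x : L, lie x x = 0;
  lie_jacobi : forall x y z : L,
    lie x (lie y z) + lie y (lie z x) + lie z (lie x y) = 0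
}.

#[short(type="lieAlgType")]
HB.structure Definition LieAlgebra (K : fieldType) :=
  { L of GRing.Lmodule K L & Lmodule_isLieAlgebra K L }.

Section LieAlgebraTheory.
Context {K : fieldType} {L : lieAlgType K}.
Implicit Types (x s n : L) (A V W k l h t : set L).

Definition linear_subspace V := submod_closed (mem V).

Definition linear_span A : set L := smallest linear_subspace A.

Definition finite_dim V := exists2 A, finite_set A & V = linear_span A.

Definition lie_set A V : set L :=
  linear_span [set lie x y | x in A & y in V].

Definition subalgebra k :=
  linear_subspace k /\ (forall x y, k x -> k y -> k (lie x y)).

Definition ad_stable A V := forall x y, A x -> V y -> V (lie x y).

(* complete reducibility of V under the operators ad x, x in A *)
Definition ad_semisimple A V :=
  forall U, linear_subspace U -> U `<=` V -> ad_stable A U ->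
  exists W, [/\ linear_subspace W, W `<=` V, ad_stable A W, U `&` W = [set 0]
    & [set u + w | u in U & w in W] = V].

Definition reductive_in k l := ad_semisimple k l.

(* Bourbaki's definition: the adjoint representation is semisimple *)
Definition reductive k := reductive_in k k.

Definition reductive_exhaustion (g_ : nat -> set L) :=
  [/\ forall i, [/\ subalgebra (g_ i), finite_dim (g_ i) & reductive (g_ i)],
      forall i, g_ i `<=` g_ i.+1,
      forall i, reductive_in (g_ i) (g_ i.+1)
    & \bigcup_i g_ i = setT].

Definition semisimple_in k x := k x /\ ad_semisimple [set x] k.

Definition nilpotent_in k x :=
  lie_set k k x /\ exists i, forall y, k y -> iter i (lie x) y = 0.

(* The next two notions depend neither on the exhaustion nor on the index i
   with x in g_ i. *)
Definition semisimple_elt x :=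
  exists2 g_, reductive_exhaustion g_ & exists i, semisimple_in (g_ i) x.

Definition nilpotent_elt x :=
  exists2 g_, reductive_exhaustion g_ & exists i, nilpotent_in (g_ i) x.

(* s = x_ss and n = x_nil; in a locally reductive Lie algebra every x has
   exactly one such pair (s, n). *)
Definition jordan_decomposition x s n :=
  [/\ x = s + n, lie s n = 0, semisimple_elt s & nilpotent_elt n].

Definition ss_part h : set L :=
  [set s | exists2 x, h x & exists n, jordan_decomposition x s n].

Definition splittable h :=
  forall x, h x -> exists s n, [/\ jordan_decomposition x s n, h s & h n].

Definition toral t := subalgebra t /\ t `<=` semisimple_elt.

Definition maximal_toral t :=
  toral t /\ (forall t', toral t' -> t `<=` t' -> t' = t).

Definition centralizer A : set L := [set y | forall x, A x -> lie x y = 0].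

Definition normalizer h : set L := [set y | forall x, h x -> h (lie y x)].

Definition self_normalizing h := normalizer h = h.

Definition lower_central k i : set L := iter i (lie_set k) k.

Definition nilpotent k := exists i, lower_central k i = [set 0].

Definition locally_nilpotent h :=
  forall A, finite_set A -> A `<=` h ->
  exists k, [/\ subalgebra k, k `<=` h, nilpotent k & A `<=` k].

Definition cartan_subalgebra h :=
  [/\ subalgebra h, locally_nilpotent h & h = centralizer (ss_part h)].

Definition g0 k : set L :=
  [set m | exists2 i, (0 < i)%N & forall x, k x -> iter i (lie x) m = 0].

Definition g0_bar h : set L :=
  \bigcap_(k in [set k | [/\ subalgebra k, finite_dim k & k `<=` h]]) g0 k.

End LieAlgebraTheory.

Definition locally_reductive {K : fieldType} (L : lieAlgType K) :=
  exists g_ : nat -> set L, reductive_exhaustion g_.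

(* Main.v *)
Require Import Defs.
From HB Require Import structures.
From mathcomp Require Import all_boot all_order all_algebra.
From mathcomp Require Import boolp classical_sets functions cardinality.
From mathcomp Require Import reals complex.

Import GRing.Theory Num.Theory.
Local Open Scope classical_set_scope.
Local Open Scope ring_scope.

Set Implicit Arguments.
Unset Strict Implicit.

(* For an element with Jordan decomposition x = s + n, the kernel of [ad s] is
   the generalized null space of [ad x]; hence the completed Fitting null space
   of h is always the centralizer of h_ss, and (4) says h = z(h_ss). This
   equality alone makes h_ss a toral subalgebra contained in h, maximal toral
   because toral subalgebras are abelian, and makes h locally nilpotent by
   Engel's theorem. Conversely, if t is maximal toral, then the semisimple parts
   of elements of z(t) commute with t, hence lie in t, so z(t)_ss = t.

   An element is semisimple iff its adjoint endomorphism is diagonalizable on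
   the whole of g: the span of the eigenvectors of [ad x] in g_(i+1) is a
   g_i-submodule whose complement contains no eigenvector.

   Jordan parts exist in a reductive k because the trace form of the adjoint
   representation is nondegenerate on [k, k]: an element a of its radical has
   tr (ad a . Q) = 0, where Q is the complex conjugate of the semisimple part of
   [ad a], so [ad a] is nilpotent, and Engel's theorem makes the radical
   central. The form then represents the semisimple part of [ad x], which is a
   derivation, by an inner derivation. *)

(** * Subspaces, bases and dimension counts *)

Section Subspaces.
Variables (K : fieldType) (g : lieAlgType K).
Implicit Types (V W U A : set g) (x y v w : g).

Lemma linear_subspaceP V : linear_subspace V <->
  V 0 /\ forall a x y, V x -> V y -> V (a *: x + y).
Proof.
split=> [[V0 VL]|[V0 VL]]; split.
- by move: V0; rewrite inE.
- move=> a x y Vx Vy; have := VL a x y; rewrite !inE; exact.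
- by rewrite inE.
- by move=> a x y; rewrite !inE; exact: VL.
Qed.

Lemma subspace0 V : linear_subspace V -> V 0.
Proof. by case/linear_subspaceP. Qed.

Lemma subspaceZ V a x : linear_subspace V -> V x -> V (a *: x).
Proof.
by case/linear_subspaceP=> V0 VL Vx; rewrite -[_ *: _]addr0; exact: VL.
Qed.

Lemma subspaceD V x y : linear_subspace V -> V x -> V y -> V (x + y).
Proof.
by case/linear_subspaceP=> V0 VL Vx Vy; rewrite -[x]scale1r; exact: VL.
Qed.

Lemma subspaceN V x : linear_subspace V -> V x -> V (- x).
Proof. by move=> lV Vx; rewrite -scaleN1r; exact: subspaceZ. Qed.

Lemma subspaceB V x y : linear_subspace V -> V x -> V y -> V (x - y).
Proof. by move=> lV Vx Vy; apply: subspaceD => //; exact: subspaceN. Qed.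

Lemma subspace_sum V (I : Type) (r : seq I) (P : pred I) (F : I -> g) :
  linear_subspace V -> (forall i, P i -> V (F i)) -> V (\sum_(i <- r | P i) F i).
Proof.
move=> lV VF; elim/big_rec: _ => [|i x Pi Vx]; first exact: subspace0.
by apply: subspaceD => //; exact: VF.
Qed.

Lemma linear_span_subspace A : linear_subspace (linear_span A).
Proof.
apply/linear_subspaceP; split=> [V [lV _]|a x y Ax Ay V [lV AV]].
  exact: subspace0.
by apply: subspaceD => //; [apply: subspaceZ => //; exact: Ax|exact: Ay].
Qed.

Lemma sub_linear_span A : A `<=` linear_span A.
Proof. by move=> x Ax V [_]; exact. Qed.

Lemma linear_span_min A V :
  linear_subspace V -> A `<=` V -> linear_span A `<=` V.
Proof. by move=> lV AV x; exact. Qed.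

Lemma linear_spanS A B : A `<=` B -> linear_span A `<=` linear_span B.
Proof.
move=> AB; apply: linear_span_min; first exact: linear_span_subspace.
by apply: (subset_trans AB); exact: sub_linear_span.
Qed.

Definition line v : set g := [set a *: v | a in setT].

Definition sum_set U W : set g := [set u + w | u in U & w in W].

Lemma line_subspace v : linear_subspace (line v).
Proof.
apply/linear_subspaceP; split=> [|a _ _ [b _ <-] [c _ <-]].
  by exists 0; rewrite ?scale0r.
by exists (a * b + c); rewrite // scalerDl scalerA.
Qed.

Lemma sum_set_subspace U W :
  linear_subspace U -> linear_subspace W -> linear_subspace (sum_set U W).
Proof.
move=> lU lW; apply/linear_subspaceP; split.
  by exists 0; [exact: subspace0|exists 0; [exact: subspace0|rewrite addr0]].
move=> a _ _ [u Uu [w Ww <-]] [u' Uu' [w' Ww' <-]].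
exists (a *: u + u'); first by apply: subspaceD => //; exact: subspaceZ.
exists (a *: w + w'); first by apply: subspaceD => //; exact: subspaceZ.
by rewrite scalerDr addrACA.
Qed.

Lemma sum_setl U W : linear_subspace W -> U `<=` sum_set U W.
Proof. by move=> lW u Uu; exists u => //; exists 0; [exact: subspace0|rewrite addr0]. Qed.

Lemma sum_setr U W : linear_subspace U -> W `<=` sum_set U W.
Proof. by move=> lU w Ww; exists 0; [exact: subspace0|exists w; rewrite ?add0r]. Qed.

Lemma sum_set_min U W V :
  linear_subspace V -> U `<=` V -> W `<=` V -> sum_set U W `<=` V.
Proof. by move=> lV UV WV _ [u Uu [w Ww <-]]; apply: subspaceD => //;
  [exact: UV|exact: WV]. Qed.

Lemma line_id v : line v v.
Proof. by exists 1; rewrite ?scale1r. Qed.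

Lemma line_min V v : linear_subspace V -> V v -> line v `<=` V.
Proof. by move=> lV Vv _ [a _ <-]; exact: subspaceZ. Qed.

(** Families are indexed by [nat] and only their first [n] members count, so that families of
    different lengths share one type. *)
Definition lincomb n (b : nat -> g) (c : 'rV[K]_n) : g := \sum_(i < n) c 0 i *: b i.

Lemma lincomb_is_linear n b : linear (@lincomb n b).
Proof.
move=> a x y; rewrite /lincomb scaler_sumr -big_split; apply: eq_bigr => i _.
by rewrite !mxE scalerDl scalerA.
Qed.
HB.instance Definition _ n b :=
  GRing.isLinear.Build K 'rV[K]_n g _ (@lincomb n b) (@lincomb_is_linear n b).

Lemma lincomb_delta n b (i : 'I_n) : lincomb b (delta_mx 0 i) = b i.
Proof.
rewrite /lincomb (bigD1 i) //= mxE !eqxx scale1r big1 ?addr0 // => j ji.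
by rewrite mxE (negPf ji) andbF scale0r.
Qed.

Definition free_family n (b : nat -> g) :=
  forall c : 'rV[K]_n, lincomb b c = 0 -> c = 0.

Definition spans n (b : nat -> g) V := V = range (@lincomb n b).

Lemma lincomb_in V n b (c : 'rV[K]_n) :
  linear_subspace V -> (forall i, (i < n)%N -> V (b i)) -> V (lincomb b c).
Proof.
by move=> lV Vb; apply: subspace_sum => // i _; apply: subspaceZ => //; exact: Vb.
Qed.

Lemma finite_dim_spans V : finite_dim V -> exists n b, spans n b V.
Proof.
case=> A /finite_seqP[s ->] ->; exists (size s), (nth 0 s).
apply/seteqP; split.
  apply: linear_span_min.
    apply/linear_subspaceP; split=> [|a _ _ [c _ <-] [d _ <-]].
      by exists 0; rewrite ?linear0.
    by exists (a *: c + d); rewrite ?linearP.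
  move=> x /= xs; have lt_is : (index x s < size s)%N by rewrite index_mem.
  by exists (delta_mx 0 (Ordinal lt_is)); rewrite // lincomb_delta nth_index.
move=> _ [c _ <-]; apply: lincomb_in => [|i lt_i].
  exact: linear_span_subspace.
by apply: sub_linear_span; exact: mem_nth.
Qed.

(** The coordinates of [e] in [b] form an n by m matrix with zero left kernel, hence of rank n. *)
Lemma free_family_size V m b n e :
  spans m b V -> (forall i, (i < n)%N -> V (e i)) -> free_family n e -> (n <= m)%N.
Proof.
move=> Vb Ve free_e.
have /choice[f fE] : forall i : 'I_n, exists c : 'rV[K]_m, lincomb b c = e i.
  by move=> i; have := Ve i (ltn_ord i); rewrite Vb => -[c _ <-]; exists c.
pose M := \matrix_(i < n) f i.
have MP (c : 'rV[K]_n) : c *m M = 0 -> c = 0.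
  move=> cM; apply: free_e.
  rewrite -[RHS](linear0 (lincomb (n:=m) b)) -cM mulmx_sum_row linear_sum.
  by apply: eq_bigr => i _; rewrite linearZ rowK /= fE.
have : row_free M.
  rewrite -kermx_eq0; apply/eqP/row_matrixP => i; rewrite row0; apply: MP.
  by apply/sub_kermxP; exact: row_sub.
by rewrite /row_free => /eqP <-; exact: rank_leq_col.
Qed.

Lemma free_family0 b : free_family 0 b.
Proof. by move=> c _; rewrite thinmx0. Qed.

Definition extend_family n (b : nat -> g) v i := if i == n then v else b i.

Lemma lincomb_extend n b v (c : 'rV[K]_n.+1) :
  lincomb (extend_family n b v) c =
  lincomb b (\row_(i < n) c 0 (widen_ord (leqnSn n) i)) + c 0 ord_max *: v.
Proof.
rewrite /lincomb big_ord_recr /= /extend_family eqxx; congr (_ + _).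
by apply: eq_bigr => i _; rewrite mxE /= ltn_eqF.
Qed.

Lemma free_family_extend n b v : free_family n b ->
  ~ range (@lincomb n b) v -> free_family n.+1 (extend_family n b v).
Proof.
move=> free_b Nv c; rewrite lincomb_extend => c0.
have cm0 : c 0 ord_max = 0.
  apply/eqP/negP => /negP cm; apply: Nv.
  exists (- (c 0 ord_max)^-1 *: \row_(i < n) c 0 (widen_ord (leqnSn n) i)) => //.
  rewrite linearZ /=; move/eqP: c0; rewrite addr_eq0 => /eqP ->.
  by rewrite scalerN scaleNr opprK scalerA mulVf // scale1r.
move: c0; rewrite cm0 scale0r addr0 => /free_b /rowP c0.
apply/rowP => i; rewrite mxE; case: (unliftP ord_max i) => [j ->|->//].
by have := c0 j; rewrite !mxE => <-; congr (c 0 _); apply: val_inj;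
  rewrite /= /bump leqNgt ltn_ord.
Qed.

Definition basis n b V := spans n b V /\ free_family n b.

Lemma spans_mem V n b i : spans n b V -> (i < n)%N -> V (b i).
Proof. by move=> -> lt_in; exists (delta_mx 0 (Ordinal lt_in)); rewrite ?lincomb_delta. Qed.

(* A free family of maximal size inside V spans V. *)
Lemma exists_basis V W : linear_subspace V -> finite_dim W -> V `<=` W ->
  exists n b, basis n b V.
Proof.
move=> lV /finite_dim_spans[m [w Ww]] VW.
pose P n := `[< exists b, (forall i, (i < n)%N -> V (b i)) /\ free_family n b >].
have P0 : exists n, P n.
  by exists 0%N; apply/asboolP; exists (fun _ => 0); split=> //; exact: free_family0.
have Pm n : P n -> (n <= m)%N.
  move=> /asboolP[b [Vb fb]]; apply: (free_family_size Ww) fb => i lt_i.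
  by apply: VW; exact: Vb.
case: (ex_maxnP P0 Pm) => n /asboolP[b [Vb fb]] max_n.
exists n, b; split=> //; apply/seteqP; split=> [v Vv|_ [c _ <-]]; last first.
  exact: lincomb_in.
apply: contrapT => Nv; suff /max_n : P n.+1 by rewrite ltnn.
apply/asboolP; exists (extend_family n b v); split; last exact: free_family_extend.
move=> i; rewrite /extend_family ltnS leq_eqVlt; case: eqP => //= _.
exact: Vb.
Qed.

Lemma finite_dimS V W : linear_subspace V -> finite_dim W -> V `<=` W ->
  finite_dim V.
Proof.
move=> lV fW VW; have [n [b [Vb _]]] := exists_basis lV fW VW.
exists [set b i | i in `I_n].
  by apply: finite_image; exact: finite_II.
apply/seteqP; split.
  move=> v; rewrite {1}Vb => -[c _ <-].
  apply: lincomb_in => [|i lt_i]; first exact: linear_span_subspace.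
  by apply: sub_linear_span; exists i.
apply: linear_span_min => // _ [i lt_i <-]; exact: (spans_mem Vb).
Qed.

End Subspaces.

(** * Polynomials in a linear operator *)

Section PolynomialAction.
Variables (K : fieldType) (g : lieAlgType K).
Implicit Types (V W U A : set g) (x y v w : g) (T : {linear g -> g}) (p q : {poly K}).

(** The vector p(T)v, summed over iterates because [g] may have infinite dimension and [T] then has
    no matrix. *)
Definition poly_act T p v := \sum_(i < size p) p`_i *: iter i T v.

Lemma iter_is_linear T i : linear (iter i T).
Proof. by elim: i => [//|i IH] a x y; rewrite /= IH linearP. Qed.

Lemma iter_linear0 T i : iter i T 0 = 0.
Proof. by elim: i => //= i ->; rewrite linear0. Qed.

Lemma poly_act_is_linear T p : linear (poly_act T p).
Proof.
move=> a x y; rewrite /poly_act scaler_sumr -big_split; apply: eq_bigr => i _.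
by rewrite iter_is_linear scalerDr !scalerA mulrC.
Qed.
HB.instance Definition _ T p :=
  GRing.isLinear.Build K g g _ (poly_act T p) (poly_act_is_linear T p).

Lemma poly_actE T p v n : (size p <= n)%N ->
  poly_act T p v = \sum_(i < n) p`_i *: iter i T v.
Proof.
move=> le_pn; rewrite /poly_act.
rewrite (big_ord_widen n (fun i => p`_i *: iter i T v) le_pn).
rewrite [RHS](bigID (fun i : 'I_n => (i < size p)%N)) /= [X in _ + X]big1 ?addr0 // => i.
by rewrite -leqNgt => /(nth_default 0) ->; rewrite scale0r.
Qed.

Lemma poly_act0 T v : poly_act T 0 v = 0.
Proof. by rewrite /poly_act size_poly0 big_ord0. Qed.

Lemma poly_actD T p q v : poly_act T (p + q) v = poly_act T p v + poly_act T q v.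
Proof.
pose n := maxn (size p) (size q).
rewrite (@poly_actE _ (p + q) _ n) ?size_polyD // (@poly_actE _ p _ n) ?leq_maxl //.
rewrite (@poly_actE _ q _ n) ?leq_maxr // -big_split; apply: eq_bigr => i _.
by rewrite coefD scalerDl.
Qed.

Lemma poly_actZ T a p v : poly_act T (a *: p) v = a *: poly_act T p v.
Proof.
rewrite (@poly_actE _ (a *: p) _ (size p)) ?size_scale_leq // /poly_act scaler_sumr.
by apply: eq_bigr => i _; rewrite coefZ scalerA.
Qed.

Lemma poly_actN T p v : poly_act T (- p) v = - poly_act T p v.
Proof. by rewrite -scaleN1r poly_actZ scaleN1r. Qed.

Lemma poly_actC T a v : poly_act T a%:P v = a *: v.
Proof.
by rewrite (@poly_actE _ _ _ 1) ?size_polyC_leq1 // big_ord1 coefC.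
Qed.

Lemma poly_act1 T v : poly_act T 1 v = v.
Proof. by rewrite poly_actC scale1r. Qed.

Lemma poly_actMX T p v : poly_act T (p * 'X) v = T (poly_act T p v).
Proof.
rewrite (@poly_actE _ _ _ (size p).+1); last first.
  by rewrite (leq_trans (size_polyMleq _ _)) // size_polyX addn2.
rewrite big_ord_recl coefMX eqxx scale0r add0r /poly_act linear_sum.
by apply: eq_bigr => i _; rewrite coefMX linearZ.
Qed.

Lemma poly_actX T v : poly_act T 'X v = T v.
Proof. by rewrite -['X]mul1r poly_actMX poly_act1. Qed.

Lemma poly_actM T p q v : poly_act T (p * q) v = poly_act T p (poly_act T q v).
Proof.
elim/poly_ind: p => [|p c IH]; first by rewrite mul0r !poly_act0.
rewrite mulrDl !poly_actD mulrAC !poly_actMX IH; congr (_ + _).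
by rewrite mul_polyC poly_actZ poly_actC.
Qed.

Lemma poly_actXsubC T a v : poly_act T ('X - a%:P) v = T v - a *: v.
Proof. by rewrite poly_actD poly_actN poly_actX poly_actC. Qed.

Lemma poly_actXn T n v : poly_act T 'X^n v = iter n T v.
Proof.
by elim: n => [|n IH]; rewrite ?poly_act1 // exprSr poly_actMX IH.
Qed.

Lemma poly_act_comm T p q v :
  poly_act T p (poly_act T q v) = poly_act T q (poly_act T p v).
Proof. by rewrite -!poly_actM mulrC. Qed.

Lemma poly_act_dvd T p q v : p %| q -> poly_act T p v = 0 -> poly_act T q v = 0.
Proof. by move=> /divpK <- pv; rewrite poly_actM pv linear0. Qed.

Definition stable T V := forall v, V v -> V (T v).

Lemma stable_iter T V i v : stable T V -> V v -> V (iter i T v).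
Proof. by move=> sV Vv; elim: i => //= i /sV. Qed.

Lemma stable_poly_act T V p : linear_subspace V -> stable T V ->
  stable (poly_act T p) V.
Proof.
move=> lV sV v Vv; apply: subspace_sum => // i _; apply: subspaceZ => //.
exact: stable_iter.
Qed.

Lemma coprimep_bezout1 p q : coprimep p q ->
  exists a b, a * p + b * q = 1.
Proof.
move=> /Bezout_coprimepP[[a b] /= /eqpP[[c d] /= /andP[c0 d0] E]].
exists ((d^-1 * c) *: a), ((d^-1 * c) *: b).
by rewrite -!scalerAl -scalerDr -scalerA E scalerA mulVf // scale1r.
Qed.

Lemma poly_act_coprime0 T p q v : coprimep p q ->
  poly_act T p v = 0 -> poly_act T q v = 0 -> v = 0.
Proof.
move=> /coprimep_bezout1[a [b ab]] pv qv.
by rewrite -(poly_act1 T v) -ab poly_actD !poly_actM pv qv !linear0 addr0.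
Qed.

(** The components come from a Bezout relation. They are given as polynomials in [T] applied to [v],
    so that they stay in every stable subspace containing [v]. *)
Lemma poly_act_split T p q v : coprimep p q -> poly_act T (p * q) v = 0 ->
  exists a b, v = poly_act T a v + poly_act T b v /\
   (poly_act T p (poly_act T a v) = 0 /\ poly_act T q (poly_act T b v) = 0).
Proof.
move=> /coprimep_bezout1[a [b ab]] pqv.
exists (b * q), (a * p); rewrite -poly_actD addrC ab poly_act1; split=> //.
split; rewrite -poly_actM; apply: poly_act_dvd pqv.
  by rewrite mulrCA dvdp_mull.
by rewrite mulrCA [q * p]mulrC dvdp_mull.
Qed.

End PolynomialAction.

(** * Primary decomposition over an algebraically closed field *)

Section PrimaryDecomposition.
Variables (C : closedFieldType) (g : lieAlgType C).
Implicit Types (V W U A : set g) (x y v w : g) (T : {linear g -> g}) (p q : {poly C}).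

Definition gen_eigen T (a : C) v := exists k, poly_act T (('X - a%:P) ^+ k) v = 0.

(** One exponent serves all roots: for [m] large enough this is a multiple of any given nonzero
    polynomial with roots in [s]. *)
Definition primary_poly (s : seq C) m : {poly C} := \prod_(z <- s) ('X - z%:P) ^+ m.

Lemma primary_poly_cons z s m :
  primary_poly (z :: s) m = ('X - z%:P) ^+ m * primary_poly s m.
Proof. exact: big_cons. Qed.

Lemma coprimep_primary_poly s m z k : z \notin s ->
  coprimep (('X - z%:P) ^+ k) (primary_poly s m).
Proof.
move=> zs; apply: coprimep_expl; rewrite coprimep_sym coprimep_XsubC.
rewrite /root /primary_poly horner_prod; elim: s zs => [|y s IH];
  first by rewrite big_nil oner_eq0.
rewrite inE negb_or => /andP[zy /IH s0]; rewrite big_cons mulf_neq0 //.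
by rewrite horner_exp hornerXsubC expf_neq0 // subr_eq0.
Qed.

Lemma primary_span T U s m v : linear_subspace U -> stable T U -> uniq s -> U v ->
  poly_act T (primary_poly s m) v = 0 ->
  linear_span [set u | U u /\
    exists2 a, a \in s & poly_act T (('X - a%:P) ^+ m) u = 0] v.
Proof.
move=> lU sU; elim: s v => [|z s IH] v.
  rewrite /primary_poly big_nil poly_act1 => _ _ ->.
  by apply: subspace0; exact: linear_span_subspace.
move=> /= /andP[zs us] Uv; rewrite primary_poly_cons.
move=> /(poly_act_split (coprimep_primary_poly m m zs))[a [b [vE [av bv]]]]; rewrite vE.
apply: (subspaceD (linear_span_subspace _)).
  apply: sub_linear_span; split; first exact: stable_poly_act.
  by exists z; [rewrite inE eqxx|exact: av].
have := IH (poly_act T b v) us (stable_poly_act b lU sU Uv) bv.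
apply: linear_spanS => u [Uu [c cs uc]]; split=> //; exists c => //.
by rewrite inE cs orbT.
Qed.

(** The n + 1 vectors v, Tv, ..., T^n v lie in a space spanned by n vectors, so they are
    dependent. *)
Lemma local_annihilator T V n b v : stable T V -> spans n b V -> V v ->
  exists p, [/\ p != 0, (size p <= n.+1)%N & poly_act T p v = 0].
Proof.
move=> sV Vb Vv; pose e i := iter i T v.
have /existsNP[c /not_implyP[c0 cN0]] : ~ free_family n.+1 e.
  move=> /(free_family_size Vb) => /(_ (fun i _ => stable_iter i sV Vv)).
  by rewrite ltnn.
exists (rVpoly c); split.
- by apply/eqP => p0; apply: cN0; rewrite -[c]rVpolyK p0 linear0.
- exact: size_poly.
- rewrite (@poly_actE _ _ _ _ _ n.+1) ?size_poly // -[RHS]c0.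
  by apply: eq_bigr => i _; rewrite coef_rVpoly_ord.
Qed.

(** Replaces an exponent depending on [v] by a bound depending on [V] alone. An annihilator of
    degree at most n is X^m q with q(0) nonzero, and T^m v is killed by the coprime polynomials q
    and X^k. *)
Lemma fitting T V n b v k : stable T V -> spans n b V -> V v ->
  iter k T v = 0 -> iter n T v = 0.
Proof.
move=> sV Vb Vv Tk; have [p [p0 szp pv]] := local_annihilator sV Vb Vv.
have [m [q q0 pE]] := multiplicity_XsubC p 0.
rewrite p0 /= in q0; rewrite subr0 in pE.
have le_mn : (m <= n)%N.
  move: szp; rewrite pE size_Mmonic ?monicXn // ?size_polyXn; last first.
    by apply: contraNneq p0; rewrite pE => ->; rewrite mul0r.
  have : (0 < size q)%N by rewrite size_poly_gt0; apply: contraNneq p0; rewrite pE => ->;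
    rewrite mul0r.
  by case: (size q) => // r _; rewrite addnS /= !addSn ltnS; apply: leq_trans; exact: leq_addl.
suff Tm : iter m T v = 0 by rewrite -(subnK le_mn) iterD Tm iter_linear0.
have co : coprimep q ('X^k).
  by rewrite coprimep_expr // -['X]subr0 coprimep_XsubC.
apply: (@poly_act_coprime0 _ _ T _ _ _ co); rewrite -poly_actXn -poly_actM.
  by rewrite -pE.
by rewrite mulrC poly_actM !poly_actXn Tk iter_linear0.
Qed.

Lemma primary_annihilator T V : linear_subspace V -> finite_dim V -> stable T V ->
  exists s m, [/\ uniq s, 0 \in s, (0 < m)%N &
    forall v, V v -> poly_act T (primary_poly s m) v = 0].
Proof.
move=> lV /finite_dim_spans[n [b Vb]] sV.
have /choice[f fE] : forall i : 'I_n, exists p, p != 0 /\ poly_act T p (b i) = 0.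
  move=> i; have [p [p0 _ pb]] := local_annihilator sV Vb (spans_mem Vb (ltn_ord i)).
  by exists p.
pose chi := \prod_(i < n) f i.
have chi0 : chi != 0 by apply/prodf_neq0 => i _; have [] := fE i.
have chiV v : V v -> poly_act T chi v = 0.
  rewrite {1}Vb => -[c _ <-]; rewrite linear_sum big1 // => i _.
  rewrite linearZ /= (@poly_act_dvd _ _ _ (f i)) ?scaler0 //; last by have [] := fE i.
  by rewrite /chi (bigD1 i) //= dvdp_mulIl.
have [r rE] := closed_field_poly_normal chi.
(* The root 0 is added, and the exponent made positive, so that interpolation can later produce a
   multiple of X. The exponent exceeds every multiplicity in [r]. *)
exists (undup (0 :: r)), (size r).+1; split; rewrite ?undup_uniq ?mem_undup ?inE ?eqxx //.
move=> v /chiV; apply: poly_act_dvd; rewrite rE dvdpZl ?lead_coef_eq0 //.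
rewrite /primary_poly prodrXl; move Ps: (undup _) => s.
set P := \prod_(z <- s) _.
have : {in r, forall z, 'X - z%:P %| P}.
  move=> z zr; rewrite /P (big_rem z) ?dvdp_mulIl //.
  by rewrite -Ps mem_undup inE zr orbT.
move: P => P {rE Ps} rP; elim: r rP => [|z r IH] rP; first by rewrite big_nil dvd1p.
rewrite big_cons exprS dvdp_mul ?rP ?inE ?eqxx // IH // => y yr.
by rewrite rP // inE yr orbT.
Qed.

(** A product of linear factors kills [w]; when they are applied in turn, the last nonzero vector is
    an eigenvector. *)
Lemma exists_eigenvector T V W : linear_subspace V -> finite_dim V -> stable T V ->
  linear_subspace W -> stable T W -> W `<=` V -> (exists2 w, W w & w != 0) ->
  exists a w, [/\ W w, w != 0 & T w = a *: w].
Proof.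
move=> lV fV sV lW sW WV [w Ww w0].
have [s [m [_ _ _ /(_ w (WV w Ww))]]] := primary_annihilator lV fV sV.
rewrite /primary_poly prodrXl; set P := \prod_(z <- s) _.
have [r ->] : exists r, P ^+ m = \prod_(z <- r) ('X - z%:P).
  exists (flatten (nseq m s)); elim: m => [|m IH]; first by rewrite big_nil.
  by rewrite exprS IH /= big_cat.
elim: r w Ww w0 => [|z r IH] w Ww w0.
  by rewrite big_nil poly_act1 => /eqP; rewrite (negPf w0).
rewrite big_cons mulrC poly_actM poly_actXsubC.
have [/eqP|Tw] := eqVneq (T w - z *: w) 0.
  by rewrite subr_eq0 => /eqP Tw _; exists z, w.
by apply: IH => //; apply: subspaceB => //; [exact: sW|exact: subspaceZ].
Qed.

Lemma primary_gen_eigen T V : linear_subspace V -> finite_dim V -> stable T V ->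
  V `<=` linear_span [set u | V u /\ exists a, gen_eigen T a u].
Proof.
move=> lV fV sV v Vv; have [s [m [us _ _ sm]]] := primary_annihilator lV fV sV.
have := primary_span lV sV us Vv (sm v Vv).
by apply: linear_spanS => u [Uu [a _ ua]]; split=> //; exists a, m.
Qed.

Lemma interpolation_poly (f : C -> C) s m : uniq s ->
  exists p, {in s, forall z, ('X - z%:P) ^+ m %| p - (f z)%:P}.
Proof.
elim: s => [|z s IH] /=; first by exists 0.
move=> /andP[zs /IH[p pE]].
have [a [b ab]] := coprimep_bezout1 (coprimep_primary_poly m m zs).
(* Chinese remainders: the correction is f z - p modulo (X - z)^m and 0 modulo the factors of the
   other roots. *)
exists (p + b * primary_poly s m * ((f z)%:P - p)) => y; rewrite inE => /predU1P[->|ys].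
  have -> : b * primary_poly s m = 1 - a * ('X - z%:P) ^+ m by rewrite -ab addrC addKr.
  rewrite mulrBl mul1r addrA [p + _]addrC subrK addrAC subrr sub0r dvdpNr.
  by rewrite mulrAC dvdp_mull.
rewrite addrAC dvdp_add ?pE //; apply: dvdp_mulr; apply: dvdp_mull.
by rewrite /primary_poly (big_rem y) ?dvdp_mulIl.
Qed.

(** With [f] the identity this is the semisimple part of [T], with [f] the conjugation its
    conjugate. Since f 0 = 0, the polynomial can be a multiple of X. *)
Lemma gen_eigen_functional T V (f : C -> C) :
    linear_subspace V -> finite_dim V -> stable T V -> f 0 = 0 ->
  exists p, forall a v, V v -> gen_eigen T a v -> poly_act T ('X * p) v = f a *: v.
Proof.
move=> lV fV sV f0; have [s [m [us s0 m0 sm]]] := primary_annihilator lV fV sV.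
have [q qE] := interpolation_poly f m us.
have /dvdpP[p pE] : 'X %| q.
  have := qE 0 s0; rewrite f0 !subr0; apply: dvdp_trans.
  by rewrite -(prednK m0) exprS dvdp_mulIl.
exists p => a v Vv [k av]; rewrite mulrC -pE; apply/eqP; rewrite -subr_eq0; apply/eqP.
rewrite -(poly_actC T) -poly_actN -poly_actD.
have [sa|Nsa] := boolP (a \in s); last first.
  suff -> : v = 0 by rewrite linear0.
  exact: (poly_act_coprime0 (coprimep_primary_poly m k Nsa) av (sm v Vv)).
(* The exponent [k] is unrelated to [m], but (X - a)^m v is killed by (X - a)^k and by the product
   over the other roots, so it is zero. *)
apply: poly_act_dvd (qE a sa) _.
have Nr : a \notin rem a s by rewrite mem_rem_uniq // inE eqxx.
apply: (poly_act_coprime0 (coprimep_primary_poly m k Nr) (T := T)).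
  by rewrite poly_act_comm av linear0.
rewrite -poly_actM mulrC -primary_poly_cons.
by rewrite -[RHS](sm v Vv) /primary_poly (perm_big _ (perm_to_rem sa)).
Qed.

End PrimaryDecomposition.

(** * Engel's theorem *)

Section Engel.
Variables (K : fieldType) (g : lieAlgType K).
Implicit Types (k l I U V W : set g) (u v w x y z : g).

HB.instance Definition _ x :=
  GRing.isLinear.Build K g g _ (lie x) (fun a => lie_linearr a x).

Lemma lieDl x y z : lie (x + y) z = lie x z + lie y z.
Proof. by rewrite -[x]scale1r lie_linearl !scale1r. Qed.

Lemma lie0l x : lie 0 x = 0.
Proof. by have := lieDl 0 0 x; rewrite addr0 -{1}[lie 0 x]addr0 => /addrI. Qed.

Lemma lieZl a x y : lie (a *: x) y = a *: lie x y.
Proof. by rewrite -[a *: x]addr0 lie_linearl lie0l addr0. Qed.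

Lemma lieNl x y : lie (- x) y = - lie x y.
Proof. by rewrite -scaleN1r lieZl scaleN1r. Qed.

Lemma lieBl x y z : lie (x - y) z = lie x z - lie y z.
Proof. by rewrite lieDl lieNl. Qed.

Lemma lieC x y : lie x y = - lie y x.
Proof.
apply/eqP; rewrite -addr_eq0; have := lie_alternating (x + y).
by rewrite lieDl !linearD /= !lie_alternating addr0 add0r => ->.
Qed.

Lemma lie_leibniz x y z : lie x (lie y z) = lie (lie x y) z + lie y (lie x z).
Proof.
have := lie_jacobi x y z; rewrite (lieC z (lie x y)) (lieC z x) linearN /=.
by move/eqP; rewrite -addrA -opprD addr_eq0 opprK addrC => /eqP.
Qed.

Lemma lie_lie x y z : lie (lie x y) z = lie x (lie y z) - lie y (lie x z).
Proof. by rewrite lie_leibniz addrK. Qed.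

(** Engel's theorem for [k] acting on [V] modulo [U], phrased with subspaces to avoid quotients. *)
Definition engel_property k := forall U V,
  linear_subspace U -> linear_subspace V -> ad_stable k U -> ad_stable k V ->
  (forall x v, k x -> V v -> exists n, U (iter n (lie x) v)) ->
  ~ V `<=` U ->
  exists v, [/\ V v, ~ U v & forall x, k x -> U (lie x v)].

Lemma not_subsetP (A B : set g) : ~ A `<=` B -> exists2 v, A v & ~ B v.
Proof. by move=> /existsNP[v /not_implyP[Av NBv]]; exists v. Qed.

Lemma engel_property0 : engel_property [set 0].
Proof.
move=> U V lU lV _ _ _ /not_subsetP[v Vv NUv]; exists v; split=> // _ ->.
by rewrite lie0l; exact: subspace0.
Qed.

Lemma subalgebra_extend k y : subalgebra k -> (forall x, k x -> k (lie x y)) ->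
  subalgebra (sum_set k (line y)).
Proof.
move=> [lk kk] ky; split; first exact: (sum_set_subspace lk (line_subspace y)).
move=> _ _ [x kx [_ [a _ <-] <-]] [x' kx' [_ [b _ <-] <-]].
apply: (sum_setl (line_subspace y)).
rewrite lieDl !linearD /= !lieZl !linearZ /= lie_alternating !scaler0 addr0.
apply: subspaceD => //.
  apply: subspaceD => //; first exact: kk.
  by apply: subspaceZ => //; exact: ky.
by apply: subspaceZ => //; rewrite lieC; apply: subspaceN => //; exact: ky.
Qed.

(** The iterates of [w0] under ad y are still killed by [k] modulo [U], because [k, y] lies in [k];
    the last iterate outside [U] is killed by [y] as well. *)
Lemma engel_property_extend k y : subalgebra k -> (forall x, k x -> k (lie x y)) ->
  engel_property k -> engel_property (sum_set k (line y)).
Proof.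
move=> [lk kk] ky Ek U V lU lV sU sV nil NVU.
have ksum := sum_setl (line_subspace y) (U := k).
have ysum : sum_set k (line y) y by apply: (sum_setr lk); exact: line_id.
have [||||w0 [Vw0 NUw0 Uw0]] := Ek U V lU lV.
- by move=> x u /ksum; exact: sU.
- by move=> x u /ksum; exact: sV.
- by move=> x v /ksum; exact: nil.
- exact: NVU.
have Wi i : V (iter i (lie y) w0) /\ forall x, k x -> U (lie x (iter i (lie y) w0)).
  elim: i => [//|i [Vi Ui]] /=; split; first exact: sV.
  move=> x kx; rewrite lie_leibniz; apply: subspaceD => //; first exact/Ui/ky.
  by apply: sU => //; exact: Ui.
have Pn : exists n, `[< U (iter n (lie y) w0) >].
  by have [n Un] := nil y w0 ysum Vw0; exists n; apply/asboolP.
case: (ex_minnP Pn) => -[/asboolP //|n /asboolP Un min_n].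
exists (iter n (lie y) w0); split; first by have [] := Wi n.
  by move=> /asboolP /min_n; rewrite ltnn.
move=> _ [x kx [_ [a _ <-] <-]]; rewrite lieDl lieZl.
by apply: subspaceD => //; [exact: (Wi n).2|exact: subspaceZ].
Qed.

(* A chain of subalgebras of I, each an ideal of codimension one in the next
   one, is built by applying the Engel property of each to its action on I. *)
Lemma engel I : subalgebra I -> finite_dim I ->
  (forall x y, I x -> I y -> exists n, iter n (lie x) y = 0) -> engel_property I.
Proof.
move=> sI fI nilI; have [m [e Ie]] := finite_dim_spans fI.
(* The induction is on the size of a free family in [k]; size m + 1 is impossible in a space spanned
   by m vectors. *)
suff H d : engel_property I \/ exists k b, [/\ subalgebra k, k `<=` I,
    engel_property k, free_family d b & forall i, (i < d)%N -> k (b i)].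
  have [//|[k [b [_ kI _ fb kb]]]] := H m.+1.
  suff : (m.+1 <= m)%N by rewrite ltnn.
  by apply: (free_family_size Ie _ fb) => i /kb; exact: kI.
elim: d => [|d [|[k [b [sk kI Ek fb kb]]]]]; [right|by left|].
  exists [set 0], (fun _ => 0); split => //; last exact: free_family0.
  - split=> [|_ _ -> ->]; last by rewrite lie0l.
    by apply/linear_subspaceP; split=> // a _ _ -> ->; rewrite scaler0 addr0.
  - by move=> _ ->; apply: subspace0; case: sI.
  - exact: engel_property0.
have [Ik|NIk] := pselect (I `<=` k).
  by left; rewrite (_ : I = k) //; apply/seteqP.
have [lk kk] := sk; have [lI II] := sI.
have [||||y [Iy Nky ky]] := Ek k I lk lI; last right.
- by move=> x y; exact: kk.
- by move=> x y /kI; exact: II.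
- by move=> x v /kI Ix /(nilI x v Ix)[n xv]; exists n; rewrite xv; exact: subspace0.
- exact: NIk.
exists (sum_set k (line y)), (extend_family d b y); split.
- exact: subalgebra_extend.
- by apply: sum_set_min => //; exact: line_min.
- exact: engel_property_extend.
- by apply: free_family_extend => // -[c _ cy]; apply: Nky; rewrite -cy; exact: lincomb_in.
- move=> i; rewrite /extend_family ltnS leq_eqVlt; case: eqP => /= _ => [_|/kb].
    by apply: (sum_setr lk); exact: line_id.
  exact: (sum_setl (line_subspace y)).
Qed.

Lemma lie_set_in (A V W : set g) : linear_subspace W ->
  (forall x y, A x -> V y -> W (lie x y)) -> lie_set A V `<=` W.
Proof.
by move=> lW AVW; apply: linear_span_min => // _ [x Ax [y Vy <-]]; exact: AVW.
Qed.

Lemma lie_setS (A V W : set g) : V `<=` W -> lie_set A V `<=` lie_set A W.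
Proof.
move=> VW; apply: linear_spanS => _ [x Ax [y Vy <-]].
by exists x => //; exists y => //; exact: VW.
Qed.

(* The ascending chain U below is built from the Engel property, one
   dimension at a time; it dominates the lower central series. *)
Lemma engel_nilpotent k : subalgebra k -> finite_dim k ->
  (forall x y, k x -> k y -> exists n, iter n (lie x) y = 0) -> nilpotent k.
Proof.
move=> sk fk nilk; have Ek := engel sk fk nilk; have [lk kk] := sk.
have [m [e ke]] := finite_dim_spans fk.
have it0 i : iter i (lie_set k) k 0.
  by case: i => [|i]; [exact: subspace0|apply: subspace0; exact: linear_span_subspace].
suff H d : nilpotent k \/ exists U b, [/\ linear_subspace U, U `<=` k, ad_stable k U,
    iter d (lie_set k) U `<=` [set 0] &
    free_family d b /\ forall i, (i < d)%N -> U (b i)].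
  have [//|[U [b [_ Uk _ _ [fb Ub]]]]] := H m.+1.
  suff : (m.+1 <= m)%N by rewrite ltnn.
  by apply: (free_family_size ke _ fb) => i /Ub; exact: Uk.
elim: d => [|d [|[U [b [lU Uk sU dU [fb Ub]]]]]]; [right|by left|].
  exists [set 0], (fun _ => 0); split=> //.
  - by apply/linear_subspaceP; split=> // a _ _ -> ->; rewrite scaler0 addr0.
  - by move=> _ ->; exact: subspace0.
  - by move=> x _ _ ->; exact: linear0.
  - by split=> //; exact: free_family0.
have [kU|NkU] := pselect (k `<=` U).
  left; exists d; apply/seteqP; split=> [|_ ->]; last exact: it0.
  by move: dU; rewrite (_ : U = k) //; apply/seteqP.
have [|||v [kv NUv Uv]] := Ek U k lU lk sU; last right.
- by move=> x y; exact: kk.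
- by move=> x v kx /(nilk x v kx)[n xv]; exists n; rewrite xv; exact: subspace0.
- exact: NkU.
have lU' := sum_set_subspace lU (line_subspace v).
have kU' : lie_set k (sum_set U (line v)) `<=` U.
  apply: lie_set_in => // x _ kx [u Uu [_ [a _ <-] <-]].
  rewrite linearD linearZ; apply: subspaceD => //; first exact: sU.
  by apply: subspaceZ => //; exact: Uv.
exists (sum_set U (line v)), (extend_family d b v); split => //.
- by apply: sum_set_min => //; exact: line_min.
- move=> x y kx U'y; apply: (sum_setl (line_subspace v)); apply: kU'.
  by apply: sub_linear_span; exists x => //; exists y.
- rewrite iterSr; apply: subset_trans dU; elim: d {fb Ub} => //= d IH.
  exact: lie_setS.
- split.
    by apply: free_family_extend => // -[c _ cv]; apply: NUv; rewrite -cv; exact: lincomb_in.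
  move=> i; rewrite /extend_family ltnS leq_eqVlt; case: eqP => /= _ => [_|/Ub].
    by apply: (sum_setr lU); exact: line_id.
  exact: (sum_setl (line_subspace v)).
Qed.

End Engel.

(** * Traces of operators on a finite-dimensional subspace *)

Section Trace.
Variables (C : closedFieldType) (g : lieAlgType C) (n : nat) (b : nat -> g) (V : set g).
Hypothesis bV : basis n b V.
Implicit Types (u v w x y z : g) (T S : {linear g -> g}).

(** Meaningful on [V] only; elsewhere the value is the default 0. *)
Definition coords v : 'rV[C]_n := xget 0 [set c | lincomb b c = v].

Definition mx_of (f : g -> g) : 'M[C]_n := \matrix_(i < n) coords (f (b i)).

Definition trace (f : g -> g) : C := \tr (mx_of f).

Lemma lincomb_inj : injective (@lincomb _ _ n b).
Proof.
by move=> c d /eqP; rewrite -subr_eq0 -linearB /= => /eqP/bV.2/eqP; rewrite subr_eq0 => /eqP.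
Qed.

Lemma coordK v : V v -> lincomb b (coords v) = v.
Proof. by have [-> _] := bV; case=> c _ cv; rewrite /coords;
  case: xgetP => [_ _ ->//|/(_ c)]. Qed.

Lemma lincombK c : coords (lincomb b c) = c.
Proof. by apply: lincomb_inj; apply: coordK; have [-> _] := bV; exists c. Qed.

Lemma coord_linear a u v : V u -> V v -> coords (a *: u + v) = a *: coords u + coords v.
Proof. by move=> Vu Vv; rewrite -{1}(coordK Vu) -{1}(coordK Vv) -linearP lincombK. Qed.

Lemma coord_mx T v : stable T V -> V v -> coords (T v) = coords v *m mx_of T.
Proof.
move=> sT Vv; apply: lincomb_inj.
have Vb i : (i < n)%N -> V (b i) by move=> lt_i; exact: (spans_mem bV.1).
rewrite coordK; last exact: sT.
rewrite mulmx_sum_row linear_sum -{1}(coordK Vv) linear_sum; apply: eq_bigr => i _.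
by rewrite !linearZ rowK /= coordK //; exact/sT/Vb.
Qed.

Lemma trace_ext (f1 f2 : g -> g) : (forall v, V v -> f1 v = f2 v) -> trace f1 = trace f2.
Proof.
move=> f12; congr (\tr _); apply/row_matrixP => i; rewrite !rowK f12 //.
exact: (spans_mem bV.1).
Qed.

Lemma traceP a (f1 f2 : g -> g) : (forall v, V v -> V (f1 v)) -> (forall v, V v -> V (f2 v)) ->
  trace (fun v => a *: f1 v + f2 v) = a * trace f1 + trace f2.
Proof.
move=> V1 V2; rewrite /trace -mxtraceZ -mxtraceD; congr (\tr _).
apply/row_matrixP => i; rewrite linearP !rowK coord_linear ?rowK //=.
- by rewrite !rowK.
- by apply: V1; exact: (spans_mem bV.1).
- by apply: V2; exact: (spans_mem bV.1).
Qed.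

Lemma traceB (f1 f2 : g -> g) : (forall v, V v -> V (f1 v)) -> (forall v, V v -> V (f2 v)) ->
  trace (fun v => f1 v - f2 v) = trace f1 - trace f2.
Proof.
move=> V1 V2; rewrite addrC -mulN1r -traceP //; apply: trace_ext => v _.
by rewrite scaleN1r addrC.
Qed.

Lemma mx_of_comp S T : stable S V -> stable T V ->
  mx_of (fun v => S (T v)) = mx_of T *m mx_of S.
Proof.
move=> sS sT; apply/row_matrixP => i; rewrite row_mul !rowK coord_mx //.
by apply: sT; exact: (spans_mem bV.1).
Qed.

Lemma traceC S T : stable S V -> stable T V ->
  trace (fun v => S (T v)) = trace (fun v => T (S v)).
Proof. by move=> sS sT; rewrite /trace !mx_of_comp // mxtrace_mulC. Qed.

Lemma trace_eigenvalues T : stable T V -> exists s : seq C,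
  trace T = \sum_(a <- s) a /\
  forall a, a \in s <-> exists v, [/\ V v, v != 0 & T v = a *: v].
Proof.
move=> sT; have [s sE] := closed_field_poly_normal (char_poly (mx_of T)).
have := char_poly_monic (mx_of T); rewrite monicE => /eqP lc1; rewrite lc1 scale1r in sE.
have szs : size s = n.
  by apply: succn_inj; rewrite -(size_char_poly (mx_of T)) sE size_prod_XsubC.
exists s; split=> [|a].
  (* The trace is a coefficient of the characteristic polynomial only for positive [n]. *)
  rewrite /trace; case: (posnP n) => [n0|n0].
    have /size0nil -> : size s = 0%N by rewrite szs.
    rewrite big_nil; apply: big1 => i _.
    by have := eq_leq n0; rewrite leqNgt (leq_ltn_trans (leq0n i) (ltn_ord i)).
  apply: oppr_inj; rewrite -char_poly_trace // sE -szs.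
  by rewrite -coefPn_prod_XsubC // szs -lt0n.
rewrite -root_prod_XsubC -sE -eigenvalue_root_char; split.
  move=> /eigenvalueP[c cT c0]; have Vc : V (lincomb b c) by have [-> _] := bV; exists c.
  exists (lincomb b c); split.
  - exact: Vc.
  - by apply: contraNneq c0 => c0; rewrite (bV.2 _ c0).
  - by rewrite -[LHS]coordK ?coord_mx ?lincombK ?cT ?linearZ //; exact: sT.
move=> [v [Vv v0 Tv]]; apply/eigenvalueP; exists (coords v).
  by rewrite -coord_mx // Tv -{1}(coordK Vv) -linearZ lincombK.
by apply: contraNneq v0 => c0; rewrite -(coordK Vv) c0 linear0.
Qed.

End Trace.

(** * Diagonalizable operators and generalized eigenspaces *)

Section EigenSpan.
Variables (C : closedFieldType) (g : lieAlgType C).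
Implicit Types (A k U V W : set g) (u v w x y z : g) (T S : {linear g -> g}).

Definition eigenvectors T : set g := [set v | exists a, T v = a *: v].

(** A form of semisimplicity that mentions neither an exhaustion nor an index. *)
Definition ad_diagonalizable x := forall v, linear_span (eigenvectors (lie x)) v.

(** The annihilator is squarefree: for a sum, the two root lists are merged without repetition. *)
Lemma eigen_span_annihilator T v : linear_span (eigenvectors T) v ->
  exists2 s, uniq s & poly_act T (primary_poly s 1) v = 0.
Proof.
suff H : linear_span (eigenvectors T) `<=`
    [set v | exists2 s, uniq s & poly_act T (primary_poly s 1) v = 0] by exact: H.
apply: linear_span_min.
  apply/linear_subspaceP; split=> [|a u w [s us su] [t ut tw]].
    by exists [::]; rewrite // linear0.
  exists (undup (s ++ t)); first exact: undup_uniq.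
  have dvd r : uniq r -> {subset r <= s ++ t} ->
      primary_poly r 1 %| primary_poly (undup (s ++ t)) 1.
    rewrite /primary_poly => ur rst; rewrite [X in _ %| X](bigID (mem r)) /=.
    apply: dvdp_mulr; rewrite -[X in _ %| X]big_filter [X in _ %| X](@perm_big _ _ _ _ _
      r) ?dvdpp //.
    apply: uniq_perm => [||z]; rewrite ?filter_uniq ?undup_uniq //.
    by rewrite mem_filter mem_undup; case: (boolP (z \in r)) => // /rst ->.
  rewrite linearP /= (poly_act_dvd (dvd s us _) su) ?(poly_act_dvd (dvd t ut _) tw).
  - by rewrite scaler0 addr0.
  - by move=> z zt; rewrite mem_cat zt orbT.
  - by move=> z zs; rewrite mem_cat zs.
move=> u [a ua]; exists [:: a] => //.
by rewrite /primary_poly big_seq1 expr1 poly_actXsubC ua subrr.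
Qed.

(** The eigencomponents of [v] are polynomials in [T] applied to [v], so they remain in [U]. *)
Lemma eigen_span_restrict T U v : linear_subspace U -> stable T U -> U v ->
  linear_span (eigenvectors T) v -> linear_span (eigenvectors T `&` U) v.
Proof.
move=> lU sU Uv /eigen_span_annihilator[s us sv].
have := primary_span lU sU us Uv sv; apply: linear_spanS => u [Uu [a _]].
rewrite expr1 poly_actXsubC => /eqP; rewrite subr_eq0 => /eqP au.
by split=> //; exists a.
Qed.

(** A squarefree annihilator contains X at most once, so T v is killed by the product over the
    nonzero roots, which is coprime to X^n. *)
Lemma eigen_span_iter0 T n v : linear_span (eigenvectors T) v ->
  iter n T v = 0 -> T v = 0.
Proof.
move=> /eigen_span_annihilator[s us sv] nv.
have N0 : 0 \notin rem 0 s by rewrite mem_rem_uniq // inE eqxx.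
apply: (poly_act_coprime0 (coprimep_primary_poly 1 n N0) (T := T)).
  by rewrite subr0 poly_actXn -iterSr iterS nv linear0.
rewrite -poly_actX -poly_actM; apply: poly_act_dvd sv.
have [s0|s0] := boolP (0 \in s); last by rewrite rem_id ?dvdp_mulIl.
by rewrite /primary_poly (perm_big _ (perm_to_rem s0)) big_cons expr1 subr0 mulrC.
Qed.

Lemma eigenspace_subspace T a : linear_subspace [set v | T v = a *: v].
Proof.
apply/linear_subspaceP; split=> [|c u v /= au av]; first by rewrite /= linear0 scaler0.
by rewrite linearP /= au av scalerDr !scalerA mulrC.
Qed.

(** ad y preserves each eigenspace of ad x, so an eigenvector of ad x splits into common
    eigenvectors. *)
Lemma ad_diagonalizable_lin a x y : lie x y = 0 ->
  ad_diagonalizable x -> ad_diagonalizable y -> ad_diagonalizable (a *: x + y).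
Proof.
move=> xy dx dy v; have lS := linear_span_subspace (eigenvectors (lie (a *: x + y))).
move: v (dx v); apply: linear_span_min lS _ => v [c vc].
have sE : stable (lie y) [set u | lie x u = c *: u].
  by move=> u /= uc; rewrite lie_leibniz xy lie0l add0r uc linearZ.
have := eigen_span_restrict (eigenspace_subspace (lie x) c) sE vc (dy v).
apply: linear_spanS => u [[d ud] /= uc]; exists (a * c + d).
by rewrite /= lieDl lieZl ud uc scalerDl scalerA.
Qed.

(* A complement of the span of the eigenvectors of [ad x] contains no
   eigenvector, hence vanishes. *)
Lemma ad_semisimple_eigen_span A x V : linear_subspace V -> finite_dim V ->
  ad_stable A V -> A x -> ad_semisimple A V ->
  ad_stable A (linear_span (eigenvectors (lie x) `&` V)) ->
  V `<=` linear_span (eigenvectors (lie x) `&` V).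
Proof.
move=> lV fV sV Ax ssV sE; have lE := linear_span_subspace (eigenvectors (lie x) `&` V).
have EV : linear_span (eigenvectors (lie x) `&` V) `<=` V.
  by apply: linear_span_min => // v [].
have [W [lW WV sW EW EWV]] := ssV _ lE EV sE.
have W0 w : W w -> w = 0.
  move=> Ww; apply/eqP/negP => /negP w0.
  have [a [u [Wu u0 ua]]] : exists a u, [/\ W u, u != 0 & lie x u = a *: u].
    apply: (exists_eigenvector lV fV _ lW _ WV); last by exists w.
      by move=> v; exact: sV.
    by move=> v; exact: sW.
  suff : u = 0 by move/eqP; rewrite (negPf u0).
  have : (linear_span (eigenvectors (lie x) `&` V) `&` W) u; last by rewrite EW.
  by split=> //; apply: sub_linear_span; split; [exists a|exact: WV].
by rewrite -{1}EWV => _ [u Eu [w /W0 -> <-]]; rewrite addr0.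
Qed.

(* The complement is built by adding eigenvectors from a spanning list. *)
Lemma eigen_span_ad_semisimple x V : linear_subspace V -> finite_dim V ->
  V `<=` linear_span (eigenvectors (lie x) `&` V) -> ad_semisimple [set x] V.
Proof.
move=> lV [A /finite_seqP[s ->] VA] VE U lU UV sU.
have [t [tE sV]] : exists t : seq g, (forall v, v \in t -> (eigenvectors (lie x) `&` V) v) /\
    forall W, linear_subspace W -> (forall v, v \in t -> W v) -> V `<=` W.
  have : forall v, v \in s -> exists t : seq g,
      (forall v, v \in t -> (eigenvectors (lie x) `&` V) v) /\
      forall W, linear_subspace W -> (forall v, v \in t -> W v) -> W v.
    move=> v vs; have {vs} /VE : V v by rewrite VA; exact: sub_linear_span.
    suff : linear_span (eigenvectors (lie x) `&` V) `<=` [set v | exists t : seq g,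
      (forall v, v \in t -> (eigenvectors (lie x) `&` V) v) /\
      forall W, linear_subspace W -> (forall v, v \in t -> W v) -> W v] by exact.
    apply: linear_span_min => [|u Eu]; last first.
      exists [:: u]; split=> [w|W _ Wu]; first by rewrite inE => /eqP ->.
      by apply: Wu; rewrite inE.
    apply/linear_subspaceP; split.
      by exists [::]; split=> // W lW _; exact: subspace0.
    move=> a u w [t [tE tu]] [t' [tE' tw]]; exists (t ++ t'); split.
      by move=> z; rewrite mem_cat => /orP[/tE|/tE'].
    move=> W lW Wt; apply: subspaceD => //.
      apply: subspaceZ => //; apply: tu => // z zt; apply: Wt.
      by rewrite mem_cat zt.
    by apply: tw => // z zt; apply: Wt; rewrite mem_cat zt orbT.
  move=> H; suff [t [tE sW]] : exists t : seq g,
      (forall v, v \in t -> (eigenvectors (lie x) `&` V) v) /\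
      forall W, linear_subspace W -> (forall v, v \in t -> W v) -> forall v, v \in s -> W v.
    exists t; split=> // W lW Wt; rewrite VA; apply: linear_span_min => // v /=.
    exact: sW.
  elim: s H {VA} => [|v s IH] H; first by exists [::].
  have [|t [tE tW]] := IH; first by move=> w ws; apply: H; rewrite inE ws orbT.
  have [|t' [tE' tW']] := H v; first by rewrite inE eqxx.
  exists (t ++ t'); split=> [w|W lW Wt w]; first by rewrite mem_cat => /orP[/tE|/tE'].
  rewrite inE => /predU1P[->|].
    by apply: tW' => // z zt; apply: Wt; rewrite mem_cat zt orbT.
  by apply: tW => // z zt; apply: Wt; rewrite mem_cat zt.
suff [W [lW WV sW UW Wt]] : exists W, [/\ linear_subspace W, W `<=` V, ad_stable [set x] W,
    U `&` W = [set 0] & forall v, v \in t -> sum_set U W v].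
  exists W; split=> //; apply/seteqP; split; first exact: sum_set_min.
  by apply: sV; [exact: sum_set_subspace|exact: Wt].
elim: t tE {sV} => [_|v t IH tE].
  exists [set 0]; split=> //.
  - by apply/linear_subspaceP; split=> // a _ _ -> ->; rewrite scaler0 addr0.
  - by move=> _ ->; exact: subspace0.
  - by move=> y _ _ ->; exact: linear0.
  - by apply/seteqP; split=> [u [] //|_ ->]; split=> //; exact: subspace0.
have [|W [lW WV sW UW Wt]] := IH; first by move=> w wt; apply: tE; rewrite inE wt orbT.
have [UWv|NUWv] := pselect (sum_set U W v).
  by exists W; split=> // w; rewrite inE => /predU1P[->|/Wt].
have [[a va] Vv] := tE v (mem_head _ _); have lv := line_subspace v.
exists (sum_set W (line v)); split.
- exact: sum_set_subspace.
- by apply: sum_set_min => //; exact: line_min.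
- move=> _ _ -> [w Ww [_ [c _ <-] <-]]; exists (lie x w); first exact: sW.
  by exists ((c * a) *: v); [exists (c * a)|rewrite linearD linearZ /= va scalerA].
- apply/seteqP; split=> [u [Uu [w Ww [_ [c _ <-] wu]]]|_ ->]; last first.
    by split; apply: subspace0 => //; exact: sum_set_subspace.
  have c0 : c = 0.
    apply/eqP/negP => /negP c0; apply: NUWv.
    have -> : v = c^-1 *: u + (- c^-1 *: w).
      by rewrite -wu scalerDr scaleNr addrAC subrr add0r scalerA mulVf // scale1r.
    by exists (c^-1 *: u); [exact: subspaceZ|exists (- c^-1 *: w) => //; exact: subspaceZ].
  have : (U `&` W) u; last by rewrite UW.
  by split=> //; rewrite -wu c0 scale0r addr0.
- move=> w; rewrite inE => /predU1P[->|/Wt [u Uu [w' Ww' <-]]].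
    exact: (sum_setr lU (sum_setr lW (line_id v))).
  by exists u => //; exists w' => //; exact: (sum_setl lv).
Qed.

(** If [x, y] = ay and [x, v] = cv, then [x, [y, v]] = (a + c)[y, v]; hence the span of the
    eigenvectors in [V] is a k-submodule. *)
Lemma eigen_span_transfer k V x : subalgebra k -> linear_subspace V -> finite_dim V ->
  ad_stable k V -> k x -> reductive_in k V ->
  k `<=` linear_span (eigenvectors (lie x) `&` k) ->
  V `<=` linear_span (eigenvectors (lie x) `&` V).
Proof.
move=> [lk kk] lV fV sV kx ssV kE; apply: (ad_semisimple_eigen_span lV fV sV kx ssV).
have lS := linear_span_subspace (eigenvectors (lie x) `&` V).
move=> y v /kE ky Ev.
have lR w : linear_subspace [set z | linear_span (eigenvectors (lie x) `&` V) (lie z w)].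
  apply/linear_subspaceP; split=> [|a z z' /= zw zw'].
    by rewrite /= lie0l; exact: (subspace0 lS).
  by rewrite lieDl lieZl; apply: (subspaceD lS) => //; exact: (subspaceZ _ lS).
have lQ w : linear_subspace [set z | linear_span (eigenvectors (lie x) `&` V) (lie w z)].
  apply/linear_subspaceP; split=> [|a z z' /= zw zw'].
    by rewrite /= linear0; exact: (subspace0 lS).
  by rewrite linearP; apply: (subspaceD lS) => //; exact: (subspaceZ _ lS).
move: y ky; apply: linear_span_min (lR v) _ => y [[a ya] ky] /=.
move: v Ev; apply: linear_span_min (lQ y) _ => v [[c vc] Vv] /=.
apply: sub_linear_span; split; last exact: sV.
by exists (a + c); rewrite /= lie_leibniz ya vc lieZl linearZ /= -scalerDl.
Qed.

Lemma gen_eigen_subspace T a : linear_subspace (gen_eigen T a).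
Proof.
apply/linear_subspaceP; split=> [|c u v [i ui] [j vj]]; first by exists 0%N; exact: linear0.
exists (i + j)%N; rewrite linearP /= (poly_act_dvd _ ui) ?(poly_act_dvd _ vj).
- by rewrite scaler0 addr0.
- by rewrite exprD dvdp_mulIr.
- by rewrite exprD dvdp_mulIl.
Qed.

Lemma gen_eigen_unique T a c v : gen_eigen T a v -> T v = c *: v -> v != 0 -> c = a.
Proof.
move=> [k av] cv v0; apply/eqP/negP => /negP ca; move/eqP: v0; apply.
have Nac : a \notin [:: c] by rewrite inE eq_sym.
apply: (poly_act_coprime0 (coprimep_primary_poly 1 k Nac) av).
by rewrite /primary_poly big_seq1 expr1 poly_actXsubC cv subrr.
Qed.

Lemma gen_eigen0P T v : gen_eigen T 0 v <-> exists n, iter n T v = 0.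
Proof. by split=> -[n nv]; exists n; move: nv; rewrite subr0 poly_actXn. Qed.

(** Induction on the sum of the exponents, from (ad x - a - c)[u, v] = [(ad x - a)u, v] +
    [u, (ad x - c)v]. *)
Lemma gen_eigen_lie x a c u v : gen_eigen (lie x) a u -> gen_eigen (lie x) c v ->
  gen_eigen (lie x) (a + c) (lie u v).
Proof.
move=> [i ui] [j vj]; have lG := gen_eigen_subspace (lie x) (a + c).
have [n] := ubnP (i + j); elim: n i j u v ui vj => [//|n IH] i j u v ui vj lt_n.
case: i => [|i] in ui lt_n; first by rewrite poly_act1 in ui; rewrite ui lie0l;
  exact: subspace0.
case: j => [|j] in vj lt_n; first by rewrite poly_act1 in vj; rewrite vj linear0;
  exact: subspace0.
suff [m mE] : gen_eigen (lie x) (a + c) (lie x (lie u v) - (a + c) *: lie u v).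
  by exists m.+1; rewrite exprSr poly_actM poly_actXsubC.
have -> : lie x (lie u v) - (a + c) *: lie u v =
    lie (lie x u - a *: u) v + lie u (lie x v - c *: v).
  rewrite lie_leibniz lieBl linearB /= lieZl [lie u (c *: v)]linearZ /= addrACA -opprD
    -scalerDl.
  by [].
apply: (subspaceD lG); [apply: (IH i j.+1)|apply: (IH i.+1 j)] => //.
- by rewrite -poly_actXsubC -poly_actM -exprSr.
- by rewrite -poly_actXsubC -poly_actM -exprSr.
- by rewrite addnS ltnS in lt_n.
Qed.

End EigenSpan.

(** * Trace arguments for nilpotency, and derivations that are polynomials in ad x *)

Section Reductive.
Variables (C : numClosedFieldType) (g : lieAlgType C).
Implicit Types (A k U V W : set g) (u v w x y z : g) (T S Q : {linear g -> g}).

Lemma gen_eigen_eigenvector T V a u : linear_subspace V -> finite_dim V -> stable T V ->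
  V u -> gen_eigen T a u -> u != 0 -> exists v, [/\ V v, v != 0 & T v = a *: v].
Proof.
move=> lV fV sV Vu au u0; pose W := V `&` gen_eigen T a.
have lW : linear_subspace W.
  apply/linear_subspaceP; split.
    by split; [exact: subspace0|exact: (subspace0 (gen_eigen_subspace T a))].
  move=> c y z [Vy ay] [Vz az]; split.
    by apply: subspaceD => //; exact: subspaceZ.
  by apply: (subspaceD (gen_eigen_subspace T a)) => //;
    exact: (subspaceZ _ (gen_eigen_subspace T a)).
have sW : stable T W.
  move=> y [Vy [m ym]]; split; first exact: sV.
  by exists m; rewrite -(poly_actX T y) poly_act_comm ym linear0.
have [|c [v [[Vv av] v0 cv]]] := exists_eigenvector lV fV sV lW sW (@subIsetl _ _ _);
  first by exists u.
by exists v; rewrite -(gen_eigen_unique av cv v0).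
Qed.

(** Invariance of the trace, from the cyclicity tr(ad v ad u Q) = tr(ad u Q ad v). *)
Lemma trace_lie n b V u v Q : basis n b V -> stable (lie u) V -> stable (lie v) V ->
  stable Q V ->
  trace n b (fun w => lie (lie u v) (Q w)) =
  trace n b (fun w => lie u (lie v (Q w) - Q (lie v w))).
Proof.
move=> bV su sv sQ.
transitivity (trace n b (fun w => lie u (lie v (Q w)) - lie v (lie u (Q w)))).
  by apply: (trace_ext bV) => w _; rewrite lie_lie.
transitivity (trace n b (fun w => lie u (lie v (Q w)) - lie u (Q (lie v w)))); last first.
  by apply: (trace_ext bV) => w _; rewrite linearB.
rewrite !(traceB bV); try by move=> w Vw; do ?[apply: su|apply: sv|apply: sQ].
congr (_ - _); rewrite (traceC bV (S := lie v) (T := lie u \o Q)) //.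
by move=> w Vw /=; apply/su/sQ.
Qed.

Lemma trace_zero n b V : basis n b V -> trace n b (fun _ => 0) = 0.
Proof.
move=> bV; rewrite -(subrr (trace n b (@idfun g))) -(traceB bV) //.
by apply: (trace_ext bV) => w _ /=; rewrite subrr.
Qed.

Lemma lie_set_subspace A V : linear_subspace (lie_set A V).
Proof. exact: linear_span_subspace. Qed.

(* On each generalized eigenspace V_a of [ad x] in V, which is a k-submodule,
   [ad x] has trace 0 since x is in [k, k]; hence a = 0 or V_a = 0. *)
Lemma nilpotent_transfer k V x : subalgebra k -> linear_subspace V -> finite_dim V ->
  ad_stable k V -> lie_set k k x -> k `<=` gen_eigen (lie x) 0 ->
  V `<=` gen_eigen (lie x) 0.
Proof.
move=> [lk kk] lV fV sV Dx nx.
have kx : k x by apply: lie_set_in Dx => // y z; exact: kk.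
have sx : stable (lie x) V by move=> v; exact: sV.
apply: (subset_trans (primary_gen_eigen lV fV sx)).
apply: linear_span_min; first exact: gen_eigen_subspace.
move=> u [Vu [a au]]; have [<-|a0] := eqVneq a 0; first exact: au.
have [->|u0] := eqVneq u 0; first exact: (subspace0 (gen_eigen_subspace _ _)).
pose Va := V `&` gen_eigen (lie x) a; have lG := gen_eigen_subspace (lie x) a.
have lVa : linear_subspace Va.
  apply/linear_subspaceP; split; first by split; exact: subspace0.
  move=> c y z [Vy ay] [Vz az]; split; first by apply: subspaceD => //; exact: subspaceZ.
  by apply: (subspaceD lG) => //; exact: (subspaceZ _ lG).
have sVa y : k y -> stable (lie y) Va.
  move=> ky v [Vv av]; split; first exact: sV.
  by have := gen_eigen_lie (nx y ky) av; rewrite add0r.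
have VaV : Va `<=` V := @subIsetl _ _ _.
have [n [b bVa]] := exists_basis lVa fV VaV.
have tr0 : trace n b (lie x) = 0.
  suff : lie_set k k `<=` [set y | k y /\ trace n b (lie y) = 0] by move=> /(_ x Dx) [].
  apply: linear_span_min => [|_ [y ky [z kz <-]]]; last first.
    split; first exact: kk.
    transitivity (trace n b (fun w => lie y (lie z w - lie z w))).
      exact: (trace_lie bVa (sVa y ky) (sVa z kz) (Q := idfun) (fun w => id)).
    rewrite -[RHS](trace_zero bVa).
    by apply: (trace_ext bVa) => w _; rewrite subrr linear0.
  apply/linear_subspaceP; split.
    split; first exact: subspace0.
    by rewrite -[RHS](trace_zero bVa); apply: (trace_ext bVa) => w _; exact: lie0l.
  move=> c y z [ky ty] [kz tz]; split; first by apply: subspaceD => //; exact: subspaceZ.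
  transitivity (trace n b (fun w => c *: lie y w + lie z w)).
    by apply: (trace_ext bVa) => w _; rewrite lieDl lieZl.
  by rewrite (traceP bVa) ?ty ?tz ?mulr0 ?addr0 // => w; exact: sVa.
have [s [trs sE]] := trace_eigenvalues bVa (sVa x kx).
have sa : {in s, forall c, c = a}.
  move=> c /sE[v [[Vv av] v0 cv]]; exact: (gen_eigen_unique av cv v0).
have [|||||v [Vv v0 vE]] := gen_eigen_eigenvector (T := lie x) (V := Va) (a := a) (u := u) lVa.
- by apply: (finite_dimS lVa fV VaV).
- exact: sVa.
- by split.
- exact: au.
- exact: u0.
have as_ : a \in s by apply/sE; exists v.
(* All eigenvalues equal [a], so the trace is [a] times their number; in characteristic 0 their list
   is empty, yet it contains [a]. *)
move: tr0; rewrite trs big_seq (eq_bigr (fun=> a)); last by move=> c /sa.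
rewrite -big_seq big_const_seq count_predT iter_addr_0 => /eqP.
by rewrite mulrn_eq0 (negPf a0) orbF size_eq0 => /eqP s0; rewrite s0 in as_.
Qed.

(** If u and v are generalized eigenvectors for a and c, then [u, v] is one for a + c, and
    additivity of [f] is the Leibniz rule. *)
Lemma functional_derivation k x (f : C -> C) (p : {poly C}) :
    subalgebra k -> finite_dim k -> k x -> (forall a c, f (a + c) = f a + f c) ->
    (forall a v, k v -> gen_eigen (lie x) a v -> poly_act (lie x) p v = f a *: v) ->
  forall u v, k u -> k v -> poly_act (lie x) p (lie u v) =
    lie (poly_act (lie x) p u) v + lie u (poly_act (lie x) p v).
Proof.
move=> [lk kk] fk kx fD pE u v ku kv; set P := poly_act (lie x) p.
have PD c y z : P (c *: y + z) = c *: P y + P z by rewrite /P linearP.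
have sx : stable (lie x) k by move=> w; exact: kk.
have := primary_gen_eigen lk fk sx ku.
suff H : linear_span [set u | k u /\ exists a, gen_eigen (lie x) a u] `<=`
  [set u | P (lie u v) = lie (P u) v + lie u (P v)] by exact: H.
apply: linear_span_min => [|{ku}u [ku [a au]]].
  apply/linear_subspaceP; split=> [|c y z /= yE zE];
    first by rewrite /= /P !(lie0l, linear0) addr0.
  by rewrite /= !PD !lieDl !lieZl PD yE zE scalerDr addrACA.
have := primary_gen_eigen lk fk sx kv.
suff H : linear_span [set u | k u /\ exists a, gen_eigen (lie x) a u] `<=`
  [set v | P (lie u v) = lie (P u) v + lie u (P v)] by exact: H.
apply: linear_span_min => [|{kv}v [kv [c cv]]].
  apply/linear_subspaceP; split=> [|d y z /= yE zE]; first by rewrite /= /P !linear0 addr0.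
  by rewrite /= PD !linearD !linearZ /= PD yE zE scalerDr addrACA.
rewrite /= /P (pE _ _ (kk _ _ ku kv) (gen_eigen_lie au cv)) (pE _ _ ku au) (pE _ _ kv cv).
by rewrite fD scalerDl lieZl linearZ.
Qed.

(** * The trace form of a reductive algebra and the semisimple part of ad x *)

Section JordanDecomposition.
Variable k : set g.
Hypotheses (sk : subalgebra k) (fk : finite_dim k) (rk : reductive k).

Let lk : linear_subspace k := sk.1.
Let kk : forall x y, k x -> k y -> k (lie x y) := sk.2.
Let D := lie_set k k.
Let lD : linear_subspace D := lie_set_subspace k k.

Let Dk : D `<=` k.
Proof. by apply: lie_set_in. Qed.

Let D_lie x y : k x -> k y -> D (lie x y).
Proof. by move=> kx ky; apply: sub_linear_span; exists x => //; exists y. Qed.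

(** A complementary ideal [W] of [D] is central, since [W, k] lies in both [D] and [W]. *)
Lemma center_derived_sum x : k x ->
  exists z y, [/\ x = z + y, k z, D y & forall u, k u -> lie z u = 0].
Proof.
have [|W [lW Wk sW DW DWk]] := rk lD Dk.
  by move=> y d ky /Dk kd; exact: D_lie.
rewrite -{1}DWk => -[d Dd [w Ww <-]]; exists w, d; split=> //.
- by rewrite addrC.
- exact: Wk.
- move=> u ku; have : (D `&` W) (lie w u); last by rewrite DW.
  split; first by apply: D_lie => //; exact: Wk.
  by rewrite lieC; apply: subspaceN => //; exact: sW.
Qed.

(** A complementary ideal of the center contains [D], because central components drop out of
    brackets. *)
Lemma center_derived_disjoint z : D z -> (forall u, k u -> lie z u = 0) -> z = 0.
Proof.
move=> Dz zk; pose Z := [set y | k y /\ forall u, k u -> lie y u = 0].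
have lZ : linear_subspace Z.
  apply/linear_subspaceP; split.
    by split=> [|u _]; [exact: subspace0|exact: lie0l].
  move=> a x y [kx x0] [ky y0]; split; first by apply: subspaceD => //; exact: subspaceZ.
  by move=> u ku; rewrite lieDl lieZl x0 // y0 // scaler0 addr0.
have [||W [lW Wk sW ZW ZWk]] := rk lZ; first by move=> y [].
  by move=> x y kx [ky y0]; rewrite lieC y0 // oppr0; exact: subspace0.
have DW : D `<=` W.
  apply: lie_set_in => // x y kx; rewrite -{1}ZWk => -[y1 [ky1 y1k] [y2 Wy2 <-]].
  by rewrite linearD /= [lie x y1]lieC y1k // oppr0 add0r; exact: sW.
have : (Z `&` W) z; last by rewrite ZW.
by split; [split=> //; exact: Dk|exact: DW].
Qed.

Variables (n : nat) (b : nat -> g).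
Hypothesis bk : basis n b k.

(** The part in [D] of the radical of the Killing form of [k]. *)
Let I := [set a | D a /\ forall u, k u -> trace n b (fun w => lie u (lie a w)) = 0].

Let stable_lie x : k x -> stable (lie x) k.
Proof. by move=> kx y; exact: kk. Qed.

Lemma trace_ideal_subspace : linear_subspace I.
Proof.
apply/linear_subspaceP; split.
  split=> [|u ku]; first exact: subspace0.
  rewrite -[RHS](trace_zero bk); apply: (trace_ext bk) => w _.
  by rewrite lie0l linear0.
move=> c x y [Dx x0] [Dy y0]; split.
  by apply: (subspaceD lD) => //; exact: (subspaceZ _ lD).
move=> u ku.
transitivity (trace n b (fun w => c *: lie u (lie x w) + lie u (lie y w))).
  by apply: (trace_ext bk) => w _; rewrite lieDl lieZl linearP.
rewrite (traceP bk) ?x0 ?y0 ?mulr0 ?addr0 // => w kw; apply: (kk ku); apply: kk => //;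
  exact: Dk.
Qed.

Lemma trace_ideal_stable : ad_stable k I.
Proof.
move=> y a ky [Da a0]; split; first by apply: D_lie => //; exact: Dk.
move=> u ku; have := trace_lie bk (stable_lie ku) (stable_lie ky) (stable_lie (Dk Da)).
rewrite a0; last exact: kk.
move=> ->; apply: (trace_ext bk) => w _; by rewrite lie_lie.
Qed.

(* Let Q act on the a-generalized eigenspace of [ad x] as the conjugate of a.
   Then Q is a derivation with values in the ideal I, so tr (ad x . Q) = 0;
   but the eigenvalues of ad x . Q are the squared moduli of those of ad x. *)
Lemma trace_ideal_nilpotent x : I x -> k `<=` gen_eigen (lie x) 0.
Proof.
move=> Ix; have [Dx x0] := Ix; have kx := Dk Dx; have sx := stable_lie kx.
have [p pE] := gen_eigen_functional lk fk sx (conjC0 C).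
pose Q : {linear g -> g} := poly_act (lie x) ('X * p).
have QI v : k v -> I (Q v).
  (* The factor X serves here: Q v = p(ad x)[x, v], and [x, v] lies in the ideal [I]. *)
  move=> kv; rewrite /Q /= mulrC poly_actM poly_actX.
  apply: (stable_poly_act _ trace_ideal_subspace); first by move=> y; exact: trace_ideal_stable.
  by rewrite /= lieC; apply: (subspaceN trace_ideal_subspace); exact: trace_ideal_stable.
have Qd := functional_derivation sk fk kx (rmorphD (@Num.conj C)) pE.
have sQ : stable Q k by move=> v kv; apply: Dk; exact: (QI v kv).1.
have tr0 : trace n b (fun w => lie x (Q w)) = 0.
  suff : D `<=` [set y | k y /\ trace n b (fun w => lie y (Q w)) = 0] by move=> /(_ x Dx) [].
  apply: linear_span_min => [|_ [y ky [z kz <-]]].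
    apply/linear_subspaceP; split.
      split; first exact: subspace0.
      by rewrite -[RHS](trace_zero bk); apply: (trace_ext bk) => w _; exact: lie0l.
    move=> c y z [ky ty] [kz tz]; split; first by apply: subspaceD => //; exact: subspaceZ.
    transitivity (trace n b (fun w => c *: lie y (Q w) + lie z (Q w))).
      by apply: (trace_ext bk) => w _; rewrite lieDl lieZl.
    by rewrite (traceP bk) ?ty ?tz ?mulr0 ?addr0 // => w kw; apply: kk => //; exact: sQ.
  split; first exact: kk.
  (* tr(ad [y, z] Q) = tr(ad y [ad z, Q]) = - tr(ad y ad(Q z)), which is 0 since Q z lies in [I]. *)
  rewrite (trace_lie bk (stable_lie ky) (stable_lie kz) sQ).
  transitivity (trace n b (fun w => 0 - lie y (lie (Q z) w))).
    apply: (trace_ext bk) => w kw; rewrite [Q (lie z w)](Qd z w kz kw).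
    by rewrite opprD addrCA subrr addr0 linearN sub0r.
  rewrite (traceB bk) ?(trace_zero bk) ?sub0r; last first.
  - by move=> w kw; apply: (kk ky); apply: kk => //; exact: sQ.
  - by move=> w _; exact: subspace0.
  by rewrite (QI z kz).2 ?oppr0.
have sxQ : stable (lie x \o Q) k by move=> w kw /=; apply/sx/sQ.
have [s [trs sE]] := trace_eigenvalues bk sxQ.
have s_ge0 : {in s, forall c, 0 <= c}.
  move=> c /sE[v [kv v0 cv]].
  (* This eigenspace is stable under ad x because [Q] is a polynomial in ad x; an eigenvector of ad
     x in it, with eigenvalue a, shows that c is the squared modulus of a. *)
  pose W := k `&` [set w | (lie x \o Q) w = c *: w].
  have lW : linear_subspace W.
    apply/linear_subspaceP; split.
      by split; [exact: subspace0|exact: (subspace0 (eigenspace_subspace (lie x \o Q) c))].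
    move=> d y z [ky cy] [kz cz]; split; first by apply: subspaceD => //; exact: subspaceZ.
    by have /linear_subspaceP[_] := eigenspace_subspace (lie x \o Q) c; apply.
  have sW : stable (lie x) W.
    move=> y [ky cy]; split; first exact: sx.
    move: cy => /= cy; rewrite -linearZ -cy /Q /=; congr (lie x _).
    by rewrite -[RHS](poly_actX (lie x)) poly_act_comm poly_actX.
  have [|a [w [[kw cw] w0 aw]]] := exists_eigenvector lk fk sx lW sW (@subIsetl _ _ _).
    by exists v.
  have aw' : gen_eigen (lie x) a w by exists 1%N; rewrite expr1 poly_actXsubC aw subrr.
  have /eqP := cw; rewrite /= (pE a w kw aw') linearZ /= aw scalerA -subr_eq0 -scalerBl.
  by rewrite scaler_eq0 (negPf w0) orbF subr_eq0 => /eqP <-; rewrite mulrC mul_conjC_ge0.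
apply: (subset_trans (primary_gen_eigen lk fk sx)).
apply: linear_span_min; first exact: gen_eigen_subspace.
move=> u [ku [c cu]]; have [->|u0] := eqVneq u 0;
  first exact: (subspace0 (gen_eigen_subspace _ _)).
have [v [kv v0 cv]] := gen_eigen_eigenvector lk fk sx ku cu u0.
suff -> : 0 = c by [].
have cv' : gen_eigen (lie x) c v by exists 1%N; rewrite expr1 poly_actXsubC cv subrr.
have sc : c^* * c \in s.
  by apply/sE; exists v; split=> //=; rewrite (pE c v kv cv') linearZ /= cv scalerA.
move: tr0; rewrite [trace _ _ _]trs big_seq => /eqP.
rewrite psumr_eq0; last exact: s_ge0.
move=> /allP/(_ _ sc); rewrite sc /= mulrC mul_conjC_eq0 => /eqP ->.
by [].
Qed.

(** The vectors [K] killed by [I] form a submodule. In a nonzero complement, Engel's theorem for [I]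
    would give a nonzero vector of [K]. So [K] is all of [k], and [a] is both central and in [D]. *)
Lemma trace_form_nondegenerate a : D a ->
  (forall u, k u -> trace n b (fun w => lie u (lie a w)) = 0) -> a = 0.
Proof.
move=> Da a0; have Ia : I a by [].
have lI := trace_ideal_subspace; have Ik : I `<=` k by move=> x [/Dk].
have sI : subalgebra I by split=> // x y /Ik kx; exact: trace_ideal_stable.
have nilI x v : I x -> k v -> exists m, iter m (lie x) v = 0.
  by move=> Ix /(trace_ideal_nilpotent Ix)/gen_eigen0P.
have EI : engel_property I.
  apply: engel => //; first exact: (finite_dimS lI fk Ik).
  by move=> x y Ix /Ik; exact: nilI.
pose K := [set v | k v /\ forall x, I x -> lie x v = 0].
have lK : linear_subspace K.
  apply/linear_subspaceP; split.
    by split=> [|x _]; [exact: subspace0|exact: linear0].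
  move=> c x y [kx x0] [ky y0]; split; first by apply: subspaceD => //; exact: subspaceZ.
  by move=> z Iz; rewrite linearP /= x0 // y0 // scaler0 addr0.
have [||W [lW Wk sW KW KWk]] := rk lK; first by move=> y [].
  move=> y v ky [kv v0]; split; first exact: kk.
  move=> x Ix; rewrite lie_leibniz (v0 x Ix) linear0 addr0 v0 //.
  by rewrite lieC; apply: (subspaceN lI); exact: trace_ideal_stable.
have W0 w : W w -> w = 0.
  move=> Ww; apply: contrapT => w0.
  have l0 : linear_subspace [set (0 : g)].
    by apply/linear_subspaceP; split=> // c _ _ -> ->; rewrite scaler0 addr0.
  have [||||v [Wv v0 Iv]] := EI [set 0] W l0 lW.
  - by move=> x _ _ ->; exact: linear0.
  - by move=> x y /Ik; exact: sW.
  - by move=> x v Ix /Wk; exact: nilI.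
  - by move=> /(_ w Ww).
  apply: v0; have : (K `&` W) v; last by rewrite KW.
  by split=> //; split=> //; exact: Wk.
apply: center_derived_disjoint => // u; rewrite -{1}KWk => -[v [kv v0] [w /W0 -> <-]].
by rewrite addr0 v0.
Qed.

(* The trace form on D represents the functional y |-> tr (S . ad y) by some
   l in D, and then the derivation S - [ad l] of k takes values in the radical
   of the form. *)
Lemma semisimple_part_inner x : k x -> exists l p, [/\ D l,
  forall a v, k v -> gen_eigen (lie x) a v -> poly_act (lie x) ('X * p) v = a *: v &
  forall v, k v -> poly_act (lie x) ('X * p) v = lie l v].
Proof.
move=> kx; have sx := stable_lie kx.
have [p pE] := gen_eigen_functional (f := id) lk fk sx erefl.
pose S : {linear g -> g} := poly_act (lie x) ('X * p).
have SD v : k v -> D (S v).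
  move=> kv; rewrite /S /= mulrC poly_actM poly_actX.
  apply: (stable_poly_act _ lD); last exact: D_lie.
  by move=> y /Dk; exact: D_lie.
have sS : stable S k by move=> v /SD /Dk.
have Sd := functional_derivation sk fk kx (f := id) (fun _ _ => erefl) pE.
have [r [d [dD fd]]] := exists_basis lD fk Dk.
have Dd i : (i < r)%N -> D (d i) by exact: spans_mem.
have kd (i : 'I_r) : k (d i) by apply: Dk; exact: Dd.
pose kappa u v := trace n b (fun w => lie u (lie v w)).
have kappaP c y y' z : k y -> k y' -> k z -> kappa (c *: y + y') z = c * kappa y z + kappa y' z.
  move=> ky ky' kz; rewrite /kappa -(traceP bk); first last.
  - by move=> w kw; apply: (kk ky'); exact: kk.
  - by move=> w kw; apply: (kk ky); exact: kk.
  - by apply: (trace_ext bk) => w _; rewrite lieDl lieZl.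
have kappa0 z : kappa 0 z = 0.
  by rewrite -[RHS](trace_zero bk); apply: (trace_ext bk) => w _; exact: lie0l.
have kappa_sum (c : 'rV[C]_r) z : k z ->
  kappa (lincomb d c) z = \sum_(i < r) c 0 i * kappa (d i) z.
  move=> kz; suff [] : k (lincomb d c) /\ kappa (lincomb d c) z = \sum_(i < r) c 0 i *
    kappa (d i) z by [].
  rewrite /lincomb; apply: (big_rec2 (fun y s => k y /\ kappa y z = s)).
    by split; [exact: subspace0|exact: kappa0].
  move=> i s y _ [ky <-].
  by split; [apply: subspaceD => //; exact: subspaceZ|exact: kappaP].
have kappaC u v : k u -> k v -> kappa u v = kappa v u.
  by move=> ku kv; apply: (traceC bk); exact: stable_lie.
pose G := \matrix_(i < r, j < r) kappa (d i) (d j).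
(* An element of [D] orthogonal to [D] is orthogonal to [k], as the center pairs to 0 with
   everything; so the Gram matrix is invertible. *)
have G_unit : G \in unitmx.
  rewrite -row_free_unit -kermx_eq0; apply/eqP/row_matrixP => i; rewrite row0.
  set c := row i (kermx G).
  have cG : c *m G = 0 by apply/sub_kermxP; exact: row_sub.
  apply: fd; have Dc : D (lincomb d c) by exact: lincomb_in.
  have kc := Dk Dc; apply: trace_form_nondegenerate => // u ku.
  have [z [y [uE kz Dy z0]]] := center_derived_sum ku; have ky := Dk Dy.
  have zc : kappa z (lincomb d c) = 0.
    by rewrite -[RHS](trace_zero bk); apply: (trace_ext bk) => w kw; exact/z0/kk.
  rewrite -[LHS]/(kappa u (lincomb d c)) uE -[z]scale1r (kappaP _ _ _ _ kz ky kc) zc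
    mulr0 add0r.
  move: Dy; rewrite {1}dD => -[e _ <-]; have ke : k (lincomb d e) by apply: Dk;
    exact: lincomb_in.
  rewrite (kappa_sum _ _ kc) big1 // => j _.
  rewrite (kappaC _ _ (kd j) kc) (kappa_sum _ _ (kd j)).
  have cGj : (c *m G) 0 j = 0 by rewrite cG mxE.
  rewrite [X in _ * X](_ : _ = 0) ?mulr0 // -[RHS]cGj [RHS]mxE.
  by apply: eq_bigr => i' _; rewrite [G _ _]mxE.
pose phi y := trace n b (fun w => S (lie y w)).
pose c := (\row_j phi (d j)) *m invmx G.
pose l := lincomb d c; have Dl : D l by exact: lincomb_in.
have lphi_d (j : 'I_r) : kappa l (d j) = phi (d j).
  rewrite kappa_sum //.
  have /rowP/(_ j) : c *m G = \row_j phi (d j) by rewrite mulmxKV.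
  by rewrite !mxE => <-; apply: eq_bigr => i _; rewrite [G _ _]mxE.
pose E : {linear g -> g} := S \- lie l.
have sE : stable E k.
  by move=> v kv /=; apply: subspaceB => //; [exact: sS|apply: kk => //; exact: Dk].
have trE y : D y -> trace n b (fun w => E (lie y w)) = 0.
  rewrite {1}dD => -[e _ <-] {y}; pose t y := trace n b (fun w => E (lie y w)).
  suff [] : k (lincomb d e) /\ t (lincomb d e) = 0 by [].
  rewrite /lincomb; apply: (big_rec (fun y => k y /\ t y = 0)).
    split; first exact: subspace0.
    by rewrite -[RHS](trace_zero bk); apply: (trace_ext bk) => w _; rewrite lie0l linear0.
  move=> i y _ [ky ty].
  split; first by apply: subspaceD => //; exact: subspaceZ.
  transitivity (trace n b (fun w => e 0 i *: E (lie (d i) w) + E (lie y w))).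
    by apply: (trace_ext bk) => w _; rewrite lieDl lieZl linearP.
  rewrite (traceP bk); try by move=> w kw; apply/sE/kk.
  rewrite [trace _ _ (fun w => E (lie y w))]ty addr0 (traceB bk (f1 := fun w => S (lie (d i) w))
    (f2 := fun w => lie l (lie (d i) w))).
  - by rewrite [X in _ - X]lphi_d subrr mulr0.
  - by move=> w kw; apply/sS/kk.
  - by move=> w kw; apply: (kk (Dk Dl)); exact: kk.
exists l, p; split=> // v kv; apply/eqP; rewrite -subr_eq0; apply/eqP.
apply: trace_form_nondegenerate.
  by apply: (subspaceB lD); [exact: SD|apply: D_lie => //; exact: Dk].
(* tr(ad u ad(E v)) = tr(ad u [E, ad v]) = - tr(ad [u, v] E), which vanishes because [u, v] lies in
   [D]. *)
move=> u ku; rewrite -[RHS]oppr0 -(trE (lie u v)); last exact: D_lie.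
rewrite (traceC bk sE (stable_lie (kk ku kv))).
rewrite (trace_lie bk (stable_lie ku) (stable_lie kv) sE) -[RHS]sub0r -(trace_zero bk)
  -(traceB bk).
- apply: (trace_ext bk) => w kw.
  have -> : E (lie v w) = lie (E v) w + lie v (E w).
    rewrite /= [poly_act _ _ (lie v w)](Sd v w kv kw) lie_leibniz lieBl linearB /=.
    by rewrite opprD addrACA.
  by rewrite opprD addrCA subrr addr0 linearN sub0r opprK.
- by move=> w _; exact: subspace0.
- move=> w kw; apply: (kk ku); apply: subspaceB => //.
    by apply: kk => //; exact: sE.
  by apply: sE; exact: kk.
Qed.

End JordanDecomposition.

(** Write x = z + y with z central and y in [k, k], and let ad l be the semisimple part of ad x. The
    parts are z + l and y - l: the nilpotent one must lie in [k, k], so z goes to the semisimple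
    one. *)
Lemma reductive_jordan k x : subalgebra k -> finite_dim k -> reductive k -> k x ->
  exists s n, [/\ x = s + n, lie s n = 0, semisimple_in k s & nilpotent_in k n].
Proof.
move=> sk fk rk kx; have [lk kk] := sk.
have [m [b bk]] := exists_basis lk fk (@subset_refl _ k).
have [l [p [Dl pE lE]]] := semisimple_part_inner sk fk rk bk kx.
have [z [y [xE kz Dy z0]]] := center_derived_sum sk rk kx.
have Dk : lie_set k k `<=` k by apply: lie_set_in.
have ks : k (z + l) by apply: subspaceD => //; exact: Dk.
have kn : k (y - l) by apply: subspaceB => //; exact: Dk.
have sE v : k v -> lie (z + l) v = poly_act (lie x) ('X * p) v.
  by move=> kv; rewrite lieDl z0 // add0r lE.
have xsn : x = (z + l) + (y - l) by rewrite addrACA subrr addr0.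
have sx : stable (lie x) k by move=> v; exact: kk.
exists (z + l), (y - l); split=> //.
(* The left side is p(ad x)[x, x]. *)
- have : lie (z + l) x = 0.
    by rewrite sE // mulrC poly_actM poly_actX /= lie_alternating linear0.
  by rewrite {1}xsn linearD /= lie_alternating add0r.
- split=> //; apply: eigen_span_ad_semisimple => // v kv.
  have := primary_gen_eigen lk fk sx kv; apply: linear_spanS => u [ku [a au]].
  by split=> //; exists a; rewrite /= sE // (pE a).
- split; first by apply: (subspaceB (lie_set_subspace k k)).
  have [r [e ke]] := finite_dim_spans fk; exists r => v kv.
  have sn : stable (lie (y - l)) k by move=> w; exact: kk.
  suff [i iv] : exists i, iter i (lie (y - l)) v = 0 by exact: (fitting sn ke kv iv).
  apply/gen_eigen0P; move: v kv.
  apply: (subset_trans (primary_gen_eigen lk fk sx)).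
  apply: linear_span_min; first exact: gen_eigen_subspace.
  move=> v [kv [a [j vj]]]; apply/gen_eigen0P; exists j.
  (* On the generalized eigenspace of [a], the operator ad (y - l) is ad x - a. *)
  suff H i : iter i (lie (y - l)) v = poly_act (lie x) (('X - a%:P) ^+ i) v by rewrite H.
  have nE : y - l = x - (z + l) by rewrite {1}xsn addrAC subrr add0r.
  elim: i => [|i IH]; first by rewrite poly_act1.
  have vi : gen_eigen (lie x) a (poly_act (lie x) (('X - a%:P) ^+ i) v).
    by exists j; rewrite poly_act_comm vj linear0.
  have kvi : k (poly_act (lie x) (('X - a%:P) ^+ i) v) by exact: stable_poly_act.
  rewrite iterS IH exprS poly_actM poly_actXsubC -(pE a _ kvi vi) -sE //.
  by rewrite nE lieBl.
Qed.

End Reductive.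

(** * Semisimple and nilpotent elements of a locally reductive algebra *)

Section LocallyReductive.
Variables (C : numClosedFieldType) (g : lieAlgType C).
Implicit Types (A k h t U V W : set g) (s n u v w x y z : g).

Lemma exhaustionS (g_ : nat -> set g) i j : reductive_exhaustion g_ -> (i <= j)%N ->
  g_ i `<=` g_ j.
Proof.
move=> [_ gS _ _] /subnK <-; elim: (j - i)%N => [//|m IH].
by apply: (subset_trans IH); exact: gS.
Qed.

Lemma exhaustion_seq (g_ : nat -> set g) (r : seq g) : reductive_exhaustion g_ ->
  exists i, [set` r] `<=` g_ i.
Proof.
move=> Hg; elim: r => [|x r [i ri]]; first by exists 0%N.
have [_ _ _ gT] := Hg; have : (\bigcup_j g_ j) x by rewrite gT.
move=> [j _ gx]; exists (maxn i j) => y /=; rewrite inE => /predU1P[->|yr].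
  by apply: (exhaustionS Hg _ gx); exact: leq_maxr.
by apply: (exhaustionS Hg (leq_maxl _ _)); exact: ri.
Qed.

(** On [g_ i] the span of the eigenvectors is stable under ad x. Diagonalizability then climbs the
    exhaustion, each term being reductive in the next. *)
Lemma semisimple_elt_diagonalizable x : semisimple_elt x -> ad_diagonalizable x.
Proof.
move=> [g_ Hg [i [gx ssx]]] v; have [red _ redS _] := Hg.
suff H d : g_ (d + i)%N `<=` linear_span (eigenvectors (lie x) `&` g_ (d + i)%N).
  have [j jv] := exhaustion_seq [:: v] Hg.
  have : g_ (j + i)%N v.
    by apply: (exhaustionS Hg (leq_addr i j)); apply: jv; rewrite /= inE.
  by move=> /H; apply: linear_spanS => w [].
elim: d => [|d IH].
  have [[lg gg] fg _] := red i.
  have lS := linear_span_subspace (eigenvectors (lie x) `&` g_ i).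
  apply: (ad_semisimple_eigen_span lg fg (A := [set x])) => //.
    by move=> _ y -> gy; exact: gg.
  set E := linear_span _ in lS *; move=> _ y ->; move: y.
  suff H : E `<=` [set y | E (lie x y)] by exact: H.
  apply: linear_span_min => [|y [[a ya] gy]].
    apply/linear_subspaceP; split=> [|a y z /= Ey Ez]; first by rewrite /= linear0;
      exact: (subspace0 lS).
    by rewrite /= linearP; apply: (subspaceD lS) => //; exact: (subspaceZ _ lS).
  by rewrite /= ya; apply: (subspaceZ _ lS); apply: sub_linear_span; split=> //; exists a.
have [sg fg _] := red (d + i)%N; have [[lg' gg'] fg' _] := red (d + i).+1.
apply: (eigen_span_transfer sg lg' fg') => //.
- move=> y z gy gz; apply: gg' => //; exact: (exhaustionS Hg (leqnSn _)).
- by apply: (exhaustionS Hg _ gx); exact: leq_addl.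
Qed.

(** Nilpotency on [g_ i] transfers in one step to the [g_ i]-module [g_ (j + i)], chosen to contain
    [v]; the exponent therefore depends on [v]. *)
Lemma nilpotent_elt_iter0 x v : nilpotent_elt x -> exists m, iter m (lie x) v = 0.
Proof.
move=> [g_ Hg [i [Dx [m xm]]]]; have [red _ _ _] := Hg.
have [j jv] := exhaustion_seq [:: v] Hg.
have [sg fg _] := red i; have [[lg' gg'] fg' _] := red (j + i)%N.
have gji := exhaustionS Hg (leq_addl j i).
apply/gen_eigen0P; apply: (nilpotent_transfer sg lg' fg' _ Dx).
- by move=> y z /gji; exact: gg'.
- by move=> y gy; apply/gen_eigen0P; exists m; exact: xm.
- by apply: (exhaustionS Hg (leq_addr i j)); apply: jv; rewrite /= inE.
Qed.

(** * Null vectors of an element and of its semisimple part *)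

Section JordanParts.
Variables x s n : g.
Hypothesis xsn : jordan_decomposition x s n.

Let xE : x = s + n. Proof. by case: xsn. Qed.

Let sn_comm v : lie s (lie n v) = lie n (lie s v).
Proof. by case: xsn => _ sn _ _; rewrite lie_leibniz sn lie0l add0r. Qed.

Let sn_iter_comm m v : lie s (iter m (lie n) v) = iter m (lie n) (lie s v).
Proof. by elim: m => //= m <-; rewrite sn_comm. Qed.

(** On the kernel of ad x, ad s = - ad n is diagonalizable and locally nilpotent, hence 0. Induction
    on [m] then gives (ad s)^2 v = 0, whence [s, v] = 0. *)
Lemma jordan_ss_ker m v : iter m (lie x) v = 0 -> lie s v = 0.
Proof.
have [_ _ /semisimple_elt_diagonalizable ds nn] := xsn.
have ker w : lie x w = 0 -> lie s w = 0.
  move=> xw; have [j nw] := nilpotent_elt_iter0 w nn.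
  apply: (eigen_span_iter0 (ds w) (n := j)).
  suff -> : iter j (lie s) w = (-1) ^+ j *: iter j (lie n) w by rewrite nw scaler0.
  have sw : lie s w = - lie n w.
    by apply/eqP; rewrite -addr_eq0 -lieDl -xE xw.
  elim: j {nw} => [|j IH]; first by rewrite scale1r.
  rewrite iterS IH linearZ /= sn_iter_comm sw -scaleN1r -[-1 *: _]addr0.
  by rewrite iter_is_linear iter_linear0 addr0 -iterSr scalerA -exprSr.
elim: m v => [v /= ->|m IH v /= /ker]; first exact: linear0.
have sx w : lie s (lie x w) = lie x (lie s w).
  by rewrite xE !lieDl linearD /= sn_comm.
have -> : lie s (iter m (lie x) v) = iter m (lie x) (lie s v).
  by elim: m {IH} => //= m <-; rewrite sx.
by move=> /IH sv; apply: (eigen_span_iter0 (ds v) (n := 2)).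
Qed.

(** On the kernel of ad s, which ad n preserves, ad x acts as ad n. *)
Lemma jordan_ss_ker_iter v : lie s v = 0 -> exists m, iter m (lie x) v = 0.
Proof.
have [_ _ _ nn] := xsn => sv; have [m nv] := nilpotent_elt_iter0 v nn.
exists m; rewrite -nv; elim: m {nv} => //= m ->.
by rewrite {1}xE lieDl sn_iter_comm sv iter_linear0 add0r.
Qed.

End JordanParts.

(** If z in [t] satisfies [x, z] = az, then (ad z)^2 x = 0, and diagonalizability of ad z gives
    [z, x] = 0. Such z span [t]. *)
Lemma toral_abelian t x y : subalgebra t -> (forall z, t z -> ad_diagonalizable z) ->
  t x -> t y -> lie x y = 0.
Proof.
move=> [lt tt] dt tx ty; have sx : stable (lie x) t by move=> z; exact: tt.
have := eigen_span_restrict lt sx ty (dt x tx y).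
suff H : linear_span (eigenvectors (lie x) `&` t) `<=` [set z | lie x z = 0] by exact: H.
apply: linear_span_min.
  apply/linear_subspaceP; split=> [|a u v /= u0 v0]; first exact: linear0.
  by rewrite linearP /= u0 v0 scaler0 addr0.
move=> z [[a za] tz]; rewrite /= lieC.
have -> : lie z x = 0.
  apply: (eigen_span_iter0 (dt z tz x) (n := 2)).
  by rewrite /= (lieC z x) za linearN linearZ /= lie_alternating scaler0 oppr0.
exact: oppr0.
Qed.

Hypothesis hg : locally_reductive g.

Lemma diagonalizable_semisimple_elt x : ad_diagonalizable x -> semisimple_elt x.
Proof.
have [g_ Hg] := hg => dx; have [red _ _ _] := Hg.
have [i ix] := exhaustion_seq [:: x] Hg; have gx : g_ i x by apply: ix; rewrite /= inE.
have [[lg gg] fg _] := red i.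
exists g_ => //; exists i; split=> //; apply: eigen_span_ad_semisimple => // v gv.
by apply: eigen_span_restrict => // w; exact: gg.
Qed.

Lemma jordan_diagonalizable x : ad_diagonalizable x -> jordan_decomposition x x 0.
Proof.
move=> dx; split; rewrite ?addr0 ?linear0 //; first exact: diagonalizable_semisimple_elt.
have [g_ Hg] := hg; exists g_ => //; exists 0%N; split.
  by apply: subspace0; exact: linear_span_subspace.
by exists 1%N => y _; rewrite /= lie0l.
Qed.

Lemma jordan_exists x : exists s n, jordan_decomposition x s n.
Proof.
have [g_ Hg] := hg; have [red _ _ _] := Hg.
have [i ix] := exhaustion_seq [:: x] Hg; have gx : g_ i x by apply: ix; rewrite /= inE.
have [sg fg rg] := red i.
have [s [n [xE sn ss nn]]] := reductive_jordan sg fg rg gx.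
by exists s, n; split=> //; exists g_ => //; exists i.
Qed.

(** One inclusion tests on the line through each x in [h]. For the other, y and [k] lie in one
    [g_ i], where [fitting] bounds the exponents for all x in [k] at once. *)
Lemma g0_bar_centralizer h : subalgebra h -> g0_bar h = centralizer (ss_part h).
Proof.
move=> [lh hh]; apply/seteqP; split=> y.
  move=> hy s [x hx [n xsn]].
  have [|i _ iy] := hy (line x); last exact: (jordan_ss_ker xsn (iy x (line_id x))).
  split; last exact: line_min.
    split; first exact: line_subspace.
    move=> _ _ [a _ <-] [b _ <-].
    by rewrite lieZl linearZ /= lie_alternating !scaler0; exact: (subspace0 (line_subspace x)).
  exists [set x]; first exact: finite_set1.
  apply/seteqP; split; first by apply: line_min;
    [exact: linear_span_subspace|exact: sub_linear_span].
  by apply: linear_span_min; [exact: line_subspace|move=> _ ->; exact: line_id].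
move=> hy k [sk [A /finite_seqP[r ->] kE] kh].
have [g_ Hg] := hg; have [red _ _ _] := Hg.
have [i ir] := exhaustion_seq (y :: r) Hg; have [[lg gg] fg _] := red i.
have gy : g_ i y by apply: ir; rewrite /= inE eqxx.
have kg : k `<=` g_ i.
  by rewrite kE; apply: linear_span_min => // z zr; apply: ir;
    rewrite /= inE (_ : z \in r) ?orbT.
(* The successor provides the positive exponent that [g0] asks for. *)
have [m [b gb]] := finite_dim_spans fg; exists m.+1 => // x kx.
have [s [n xsn]] := jordan_exists x.
have [|j xj] := jordan_ss_ker_iter xsn (v := y).
  by apply: hy; exists x; [exact: kh|exists n].
have sx : stable (lie x) (g_ i) by move=> z; apply: gg; exact: kg.
by rewrite iterS (fitting sx gb gy xj) linear0.
Qed.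

(** * Subalgebras equal to the centralizer of their semisimple parts *)

Section SelfCentralizing.
Variable h : set g.
Hypotheses (sh : subalgebra h) (hE : h = centralizer (ss_part h)).

Let lh : linear_subspace h := sh.1.

Lemma ss_part_comm s y : ss_part h s -> h y -> lie s y = 0.
Proof. by move=> hs; rewrite {1}hE; exact. Qed.

(** Each y in [h] commutes with s, and the kernel of ad y lies in that of the semisimple part of y;
    so s centralizes h_ss. *)
Lemma ss_part_sub : ss_part h `<=` h.
Proof.
move=> s hs; rewrite hE => s' [y hy [n' ysn]].
apply: (jordan_ss_ker ysn (m := 1)).
by rewrite /= lieC ss_part_comm // oppr0.
Qed.

Lemma ss_part_diagonalizable s : ss_part h s -> ad_diagonalizable s.
Proof. by move=> [x _ [n [_ _ /semisimple_elt_diagonalizable]]]. Qed.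

Lemma diagonalizable_ss_part x : h x -> ad_diagonalizable x -> ss_part h x.
Proof. by move=> hx dx; exists x => //; exists 0; exact: jordan_diagonalizable. Qed.

(** Elements of h_ss commute, so their combinations are diagonalizable, and a diagonalizable element
    of [h] is its own semisimple part. *)
Lemma ss_part_subalgebra : subalgebra (ss_part h).
Proof.
have d0 : ad_diagonalizable (0 : g).
  by move=> v; apply: sub_linear_span; exists 0; rewrite /= lie0l scale0r.
have t0 : ss_part h 0 by apply: diagonalizable_ss_part => //; exact: subspace0.
split; last by move=> x y tx ty; rewrite ss_part_comm //; exact: ss_part_sub.
apply/linear_subspaceP; split=> // a x y tx ty; apply: diagonalizable_ss_part.
  by apply: subspaceD => //; [apply: subspaceZ => //|]; exact: ss_part_sub.
apply: ad_diagonalizable_lin; try exact: ss_part_diagonalizable.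
by apply: ss_part_comm => //; exact: ss_part_sub.
Qed.

(** The semisimple part of each x in [h] kills [h], so ad x is locally nilpotent on [h], and Engel's
    theorem applies to the intersection with [g_ i]. *)
Lemma self_centralizing_locally_nilpotent : locally_nilpotent h.
Proof.
move=> A /finite_seqP[r ->] rh; have [g_ Hg] := hg; have [red _ _ _] := Hg.
have [i ir] := exhaustion_seq r Hg; have [[lg gg] fg _] := red i.
have sk : subalgebra (h `&` g_ i).
  split.
    apply/linear_subspaceP; split; first by split; exact: subspace0.
    move=> a x y [hx gx] [hy gy].
    by split; (apply: subspaceD => //; exact: subspaceZ).
  by move=> x y [hx gx] [hy gy]; split; [exact: sh.2|exact: gg].
exists (h `&` g_ i); split=> //; last by move=> x xr; split; [exact: rh|exact: ir].
apply: engel_nilpotent => //; first exact: (finite_dimS sk.1 fg (@subIsetr _ _ _)).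
move=> x y [hx _] [hy _]; have [s [n xsn]] := jordan_exists x.
by apply: (jordan_ss_ker_iter xsn); apply: ss_part_comm => //; exists x => //; exists n.
Qed.

Lemma self_centralizing_splittable : splittable h.
Proof.
move=> x hx; have [s [n xsn]] := jordan_exists x; exists s, n.
have hs : h s by apply: ss_part_sub; exists x => //; exists n.
have [xE _ _ _] := xsn; split=> //.
have -> : n = x - s by rewrite xE addrC addKr.
exact: subspaceB.
Qed.

(** For y normalizing [h] and s in h_ss, [s, y] lies in [h], so (ad s)^2 y = 0 and hence [s, y] =
    0. *)
Lemma self_centralizing_self_normalizing : self_normalizing h.
Proof.
apply/seteqP; split=> [y ny|y hy x hx]; last exact: sh.2.
rewrite hE => s ts; apply: (eigen_span_iter0 (ss_part_diagonalizable ts y) (n := 2)).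
rewrite /= ss_part_comm // lieC; apply: subspaceN => //.
by apply: ny; exact: ss_part_sub.
Qed.

(** A larger toral subalgebra is abelian, so it centralizes h_ss and lies in [h], where
    diagonalizable elements belong to h_ss. *)
Lemma ss_part_maximal_toral : maximal_toral (ss_part h).
Proof.
split.
  split; first exact: ss_part_subalgebra.
  by move=> s /ss_part_diagonalizable; exact: diagonalizable_semisimple_elt.
move=> t' [st' t'ss] tt'; apply/seteqP; split=> // x t'x.
have dt' z : t' z -> ad_diagonalizable z by move=> /t'ss/semisimple_elt_diagonalizable.
apply: diagonalizable_ss_part; last exact: dt'.
by rewrite hE => s /tt' t's; exact: (toral_abelian st').
Qed.

End SelfCentralizing.

(** The semisimple part s of an element centralizing [t] commutes with [t], so [t] plus the line of
    s is toral and s lies in [t] by maximality. *)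
Lemma centralizer_maximal_toral t : maximal_toral t ->
  ss_part (centralizer t) = t.
Proof.
move=> [[st tss] tmax].
have dt z : t z -> ad_diagonalizable z by move=> /tss/semisimple_elt_diagonalizable.
apply/seteqP; split=> [s [x tx [n xsn]]|x tx]; last first.
  exists x; first by move=> y ty; exact: (toral_abelian st).
  by exists 0; apply: jordan_diagonalizable; exact: dt.
have ts u : t u -> lie s u = 0.
  by move=> tu; apply: (jordan_ss_ker xsn (m := 1)); rewrite /= lieC tx // oppr0.
have ds : ad_diagonalizable s by have [_ _ /semisimple_elt_diagonalizable] := xsn.
rewrite -(tmax (sum_set t (line s))).
- by apply: (sum_setr st.1); exact: line_id.
- split.
    apply: subalgebra_extend => // u tu; rewrite lieC ts // oppr0.
    exact: (subspace0 st.1).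
  move=> _ [u tu [_ [a _ <-] <-]]; apply: diagonalizable_semisimple_elt.
  by rewrite addrC; apply: ad_diagonalizable_lin; [exact: ts|exact: ds|exact: dt].
- exact: (sum_setl (line_subspace s)).
Qed.

End LocallyReductive.

Theorem theorem3p2 (R : realType) (g : lieAlgType R[i])
    (hg : locally_reductive g) (h : set g) (hh : subalgebra h) :
  [<-> cartan_subalgebra h;
       h = centralizer (ss_part h) /\ subalgebra (ss_part h);
       exists2 t : set g, maximal_toral t & h = centralizer t;
       h = g0_bar h]
  /\ (cartan_subalgebra h -> splittable h /\ self_normalizing h).
Proof.
split; last first.
  move=> [_ _ hE]; split; first exact: self_centralizing_splittable.
  exact: self_centralizing_self_normalizing.
(* The last condition becomes h = z(h_ss), so closing the cycle only requires deriving local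
   nilpotence from it. *)
rewrite (g0_bar_centralizer hg hh); tfae.
- by move=> [_ _ hE]; split=> //; exact: ss_part_subalgebra.
- by move=> [hE _]; exists (ss_part h) => //; exact: ss_part_maximal_toral.
- by move=> [t tmax ->]; rewrite centralizer_maximal_toral.
- by move=> hE; split=> //; exact: self_centralizing_locally_nilpotent.
Qed.
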